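(* Let $T$ be a tree on $n\geq 6$ vertices, and let $g_0\geq 2$ be the smallest positive integer such that $2^{g_0-1}+g_0\geq n-3$. Then $d_T(\chi_c,\mathfrak{C})\leq d_{P_{n-g_0,g_0}}(\chi_c,\mathfrak{C})$, where $P_{n-g_0,g_0}$ is the path-star tree.
   Context: For a tree $T$ and $u,v\in V(T)$, $d_T(u,v)$ is the number of edges of the $u$-$v$ path; for $X,Y\subseteq V(T)$, $d(X,Y)=\min\{d_T(x,y): x\in X, y\in Y\}$. The Laplacian matrix of $T$ is $L(T)=D(T)-A(T)$ (degree matrix minus adjacency matrix); its second smallest eigenvalue is $\mu(T)$, and a Fiedler vector is an eigenvector of $L(T)$ for $\mu(T)$. For a Fiedler vector $Y$, a vertex $v$ is a characteristic vertex with respect to $Y$ if either $Y(v)=0$ and some neighbour $u$ of $v$ has $Y(u)\neq 0$, or some neighbour $u$ of $v$ has $Y(v)Y(u)<0$. The characteristic center $\chi_c(T)$ is the set of vertices that are characteristic vertices with respect to some Fiedler vector (for trees this set is the same for each Fiedler vector). For $u,v\in V(T)$, $f_T(v,u)$ is the number of subtrees (connected subgraphs) of $T$ containing both $v$ and $u$. The eccentric subtree number of $v$ is $\epsilon_T(v)=\min\{f_T(v,u):u\in V(T)\}$, and the core center $\mathfrak{C}(T)$ is the set of vertices maximizing $\epsilon_T$. Write $d_T(\chi_c,\mathfrak{C})=d(\chi_c(T),\mathfrak{C}(T))$. For integers $1\leq g\leq n-2$, the path-star tree $P_{n-g,g}$ is the tree on $n$ vertices obtained from the path $12\cdots (n-g)$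 by attaching $g$ pendant vertices to the vertex $n-g$. *)

(* Defs.v *)
From HB Require Import structures.
From mathcomp Require Import all_boot all_order all_algebra.
From mathcomp Require Import boolp reals.

Set Implicit Arguments.
Unset Strict Implicit.
Unset Printing Implicit Defensive.

Import Order.TTheory GRing.Theory Num.Theory.

Local Open Scope nat_scope.

(* A tree on n vertices is given by its adjacency relation on 'I_n.          *)

Definition simple_graph n (e : rel 'I_n) := symmetric e /\ irreflexive e.

Definition connected n (e : rel 'I_n) := forall x y, connect e x y.

(* [ucycle] also accepts closed walks x, y, x along a single edge, which are *)
(* not cycles of the graph; cycles have at least three vertices.             *)
Definition acyclic n (e : rel 'I_n) :=
  forall p : seq 'I_n, ucycle e p -> size p < 3.

Definition tree n (e : rel 'I_n) :=
  [/\ simple_graph e, connected e & acyclic e].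

Definition simple_path n (e : rel 'I_n) (u v : 'I_n) (p : seq 'I_n) :=
  [&& path e u p, last u p == v & uniq (u :: p)].

(* The number of edges of a u-v path (the shortest one when there are        *)
(* several; in a tree the path is unique). A simple path has fewer than n    *)
(* edges.                                                                    *)
Definition dist n (e : rel 'I_n) (u v : 'I_n) : nat :=
  find (fun k => [exists p : k.-tuple 'I_n, simple_path e u v p]) (iota 0 n).

(* Distances are < n in a connected graph, so the bound n never interferes   *)
(* with the minimum over nonempty X and Y.                                   *)
Definition set_dist n (e : rel 'I_n) (X Y : {set 'I_n}) : nat :=
  \big[minn/n]_(x in X) \big[minn/n]_(y in Y) dist e x y.

Section Laplacian.
Local Open Scope ring_scope.
Variables (R : realType) (n : nat) (e : rel 'I_n).

Definition adjacency_mx : 'M[R]_n := \matrix_(i, j) (e i j)%:R.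

Definition degree_mx : 'M[R]_n := diag_mx (\row_i #|[set j | e i j]|%:R).

Definition laplacian : 'M[R]_n := degree_mx - adjacency_mx.

(* Eigenvalues are listed in nondecreasing order with multiplicity.          *)
Definition second_smallest_eigenvalue (M : 'M[R]_n) (mu : R) :=
  exists s : seq R,
    [/\ sorted <=%R s, char_poly M = \prod_(a <- s) ('X - a%:P) & mu = s`_1].

Definition fiedler_vector (Y : 'cV[R]_n) :=
  exists mu : R, [/\ second_smallest_eigenvalue laplacian mu,
    Y != 0 & laplacian *m Y = mu *: Y].

Definition characteristic_vertex (Y : 'cV[R]_n) (v : 'I_n) :=
  (Y v 0 = 0 /\ exists2 u, e v u & Y u 0 != 0) \/
  (exists2 u, e v u & Y v 0 * Y u 0 < 0).

Definition characteristic_center : {set 'I_n} :=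
  [set v | `[< exists2 Y, fiedler_vector Y & characteristic_vertex Y v >]].

End Laplacian.

(* A subgraph of e is a pair (S, F) of a set S of vertices and a set F of    *)
(* edges of e with both ends in S, where an undirected edge {x, y} is        *)
(* represented by the two ordered pairs (x, y) and (y, x).                   *)
Definition subgraph n (e : rel 'I_n)
    (G : {set 'I_n} * {set 'I_n * 'I_n}) : bool :=
  [forall x, forall y, ((x, y) \in G.2) ==>
    [&& e x y, x \in G.1, y \in G.1 & (y, x) \in G.2]].

Definition subtree n (e : rel 'I_n)
    (G : {set 'I_n} * {set 'I_n * 'I_n}) : bool :=
  subgraph e G &&
  [forall x in G.1, forall y in G.1,
     connect (fun a b => (a, b) \in G.2) x y].

Definition subtree_number n (e : rel 'I_n) (v u : 'I_n) : nat :=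
  #|[set G | [&& subtree e G, v \in G.1 & u \in G.1]]|.

(* The default value of the minimum is the value at u = v.                   *)
Definition eccentric_subtree_number n (e : rel 'I_n) (v : 'I_n) : nat :=
  \big[minn/subtree_number e v v]_u subtree_number e v u.

Definition core_center n (e : rel 'I_n) : {set 'I_n} :=
  [set v | [forall w, eccentric_subtree_number e w <=
                      eccentric_subtree_number e v]].

Definition dist_characteristic_core (R : realType) n (e : rel 'I_n) : nat :=
  set_dist e (characteristic_center R e) (core_center e).

(* P_{n-g,g} for 1 <= g <= n - 2: the path on the vertices 0, ..., n-g-1,    *)
(* and g pendant vertices n-g, ..., n-1 attached to n-g-1.                   *)
Definition path_star_arc n g (i j : 'I_n) : bool :=
  ((j == i.+1 :> nat) && (j < n - g)) ||
  ((i == (n - g).-1 :> nat) && (n - g <= j)).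

Definition path_star n g : rel 'I_n :=
  fun i j => path_star_arc g i j || path_star_arc g j i.
Arguments path_star : clear implicits.

(* Main.v *)
Require Import Defs.
From mathcomp Require Import all_boot all_order all_algebra.
From mathcomp Require Import boolp reals complex.
From mathcomp Require Import ring lra zify.
From mathcomp Require trigo.

(** Let [x] be a characteristic vertex and [c] a core vertex of the tree at
minimal distance [d > 0], and root the tree at [c].  Let [y] be the child of
[c] towards [x] and [u] a deepest proper descendant of [x].

Combinatorial half.  By minimality [y] is not a core vertex.  Subtrees through
the root are the parent-closed vertex sets, and restricting or extending such
sets along a path gives two estimates for the family of those that contain
[y]: at least the fraction 1/(dep w + 1) of them reaches a given vertex [w]
([card_upsets_le]), while only few of them reach [u] when few vertices lie off
the path from [y] to [u] ([card_upsets_ge]).  Applied to a vertex [w] at which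
the minimum defining the eccentric subtree number of [y] is attained, they show
that [w] lies on the other side of [c], at depth at least 2, and that
[dep u + 2 + g0 <= n]: a deep branch below [x] must be accompanied by many
further vertices ([core_branch_size]).

Spectral half.  Again by minimality the parent of [x] is not characteristic,
which yields a nonnegative function [psi] living strictly below [x] whose
Rayleigh quotient is at most the second eigenvalue [mu]
([characteristic_test_function]).  On the other side of [x] there is a path of
[d + 2] vertices running through [c] towards [w]; let [nu] be the smallest
eigenvalue of that path with a Dirichlet condition at [x].  A combination of
the two test functions that is orthogonal to the constants gives [mu <= nu].

Comparison.  In the path-star tree take the vertex of index [d + 2].  The
function [psi] can be rearranged beyond it without changing the energy or
decreasing the norm: on each level the largest increment is put on the path,
all others are put farther out, and the two inequalities on sizes say that
there is room ([path_star_rearrangement]).  The same two-sided argument then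
bounds the second eigenvalue of the path-star tree by [nu], and Sturm
comparison with the Dirichlet eigenvector keeps the Fiedler vector of constant
sign on the indices below [d + 2] ([path_star_char_far]).  Its characteristic
vertices thus have index at least [d + 2], whereas its core vertices have index
at most 2 ([path_star_core_le2]), so the two centers are at distance at least
[d]. *)

Set Implicit Arguments.
Unset Strict Implicit.
Unset Printing Implicit Defensive.
Import Order.TTheory GRing.Theory Num.Theory.

(** * Rooted trees and their parent-closed sets *)

Local Open Scope nat_scope.

(** All later arguments see a tree only through such a parent map and depth
map; several roots of the same tree are used side by side. *)
Definition rooted n (e : rel 'I_n) (r : 'I_n) (par : 'I_n -> 'I_n)
    (dep : 'I_n -> nat) :=
  [/\ dep r = 0, par r = r,
      forall v, v != r -> dep v = (dep (par v)).+1 &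
      forall a b, e a b = ((a != r) && (par a == b)) || ((b != r) && (par b == a))].

(** A walk joining the ends of an edge without using it can be shortened to a
simple path, which the edge closes into a cycle. *)
Lemma acyclic_bridge n (e : rel 'I_n) a b :
  symmetric e -> irreflexive e -> acyclic e -> e a b ->
  ~~ connect [rel x y | e x y && ((x, y) \notin [:: (a, b); (b, a)])] a b.
Proof.
move=> se ie ae eab; apply/negP => /connectP[p0 pp0 bl].
have [p [pp up lp]] : exists p,
    [/\ path [rel x y | e x y && ((x, y) \notin [:: (a, b); (b, a)])] a p,
        uniq (a :: p) & last a p = b].
  by case: (shortenP pp0) bl => p pp up _ lp; exists p; split.
have pe : path e a p by apply: sub_path pp => x y /andP[].
have := ae (a :: p).
rewrite /ucycle [cycle _ _]/= rcons_path pe lp se eab up => /(_ isT).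
case: p pp up lp {pe} => [|x [|y p]] //= pp _ lp _.
  by move: eab; rewrite lp ie.
by move: pp; rewrite lp !inE eqxx /= andbF.
Qed.

(** Parents are chosen by breadth-first search.  An edge that is not a
parent edge would have its ends joined by the two walks to the root, so it
would not be a bridge. *)
Lemma tree_rooted n (e : rel 'I_n) r : tree e ->
  exists par dep, rooted e r par dep.
Proof.
case=> [[se ie] ce ae].
pose wk v k := [exists p : k.-tuple 'I_n, path e r p && (last r p == v)].
have ex v : exists k, wk v k.
  have /connectP[p pp lp] := ce r v.
  by exists (size p); apply/existsP; exists (in_tuple p); rewrite pp lp eqxx.
pose dep v := ex_minn (ex v).
have depP p v : path e r p -> last r p = v -> dep v <= size p.
  move=> pp lp; rewrite /dep; case: ex_minnP => m _; apply.
  by apply/existsP; exists (in_tuple p); rewrite pp lp eqxx.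
have depE v : exists p, [/\ path e r p, last r p = v & size p = dep v].
  rewrite /dep; case: ex_minnP => m /existsP[p /andP[pp /eqP lp]] _.
  by exists p; rewrite size_tuple.
have dep_edge a b : e a b -> dep b <= (dep a).+1.
  move=> eab; have [p [pp lp <-]] := depE a.
  by rewrite -(size_rcons p b); apply: depP; rewrite ?last_rcons // rcons_path pp lp.
have exu v : v != r -> exists u, e v u && (dep v == (dep u).+1).
  move=> vr; have [p [pp lp sp]] := depE v.
  case/lastP: p pp lp sp => [|p x]; first by move=> _ /= rv; rewrite rv eqxx in vr.
  rewrite rcons_path last_rcons size_rcons => /andP[pp ex0] xv sp; subst x.
  exists (last r p); rewrite se ex0 /= eqn_leq dep_edge //= -sp ltnS.
  exact: depP pp _.
pose par v := if v == r then r else odflt r [pick u | e v u && (dep v == (dep u).+1)].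
have parP v : v != r -> e v (par v) /\ dep v = (dep (par v)).+1.
  move=> vr; rewrite /par (negPf vr); case: pickP => [u /andP[-> /eqP ->]//|h].
  by have [u] := exu v vr; rewrite h.
have dr : dep r = 0 by apply/eqP; rewrite -leqn0; exact: (depP [::]).
exists par, dep; split => //.
- by rewrite /par eqxx.
- by move=> v /parP[].
move=> a b; apply/idP/idP; last first.
  by case/orP => /andP[/parP[h _] /eqP <-] //; rewrite se.
move=> eab; apply: contraT; rewrite negb_or !negb_and !negbK => /andP[ha hb].
set e' := [rel x y | e x y && ((x, y) \notin [:: (a, b); (b, a)])].
have se' : connect_sym e'.
  apply: sym_connect_sym => x y; rewrite /= se; congr (_ && ~~ _).
  by rewrite !inE !xpair_eqE orbC [(x == _) && _]andbC [X in _ || X]andbC.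
have cr v : connect e' v r.
  elim: {v}(dep v) {-2}v (erefl (dep v)) => [|k IH] v dv.
    have [->|/parP[_]] := eqVneq v r; first exact: connect0.
    by rewrite dv.
  have [->|vr] := eqVneq v r; first exact: connect0.
  have [evp dvp] := parP v vr.
  apply: connect_trans (IH (par v) _); last by apply/eqP; rewrite -eqSS -dvp dv.
  apply: connect1; rewrite /= evp /= !inE !xpair_eqE negb_or.
  apply/andP; split.
    apply/negP => /andP[/eqP va /eqP pb]; move: ha; rewrite -va (negPf vr) /= pb.
    by rewrite eqxx.
  apply/negP => /andP[/eqP va /eqP pb]; move: hb; rewrite -va (negPf vr) /= pb.
  by rewrite eqxx.
have := acyclic_bridge se ie ae eab; rewrite -/e' => /negP[].
by apply: connect_trans (cr a) _; rewrite se' cr.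
Qed.

Section Rooted.
Variables (n : nat) (e : rel 'I_n) (r : 'I_n) (par : 'I_n -> 'I_n).
Variable dep : 'I_n -> nat.
Hypothesis rt : rooted e r par dep.

Lemma dep_root : dep r = 0. Proof. by case: rt. Qed.
Lemma par_root : par r = r. Proof. by case: rt. Qed.
Lemma depS v : v != r -> dep v = (dep (par v)).+1.
Proof. by case: rt => _ _ h _; apply: h. Qed.
Lemma edgeE a b :
  e a b = ((a != r) && (par a == b)) || ((b != r) && (par b == a)).
Proof. by case: rt. Qed.

Lemma edge_sym : symmetric e.
Proof. by move=> a b; rewrite !edgeE orbC. Qed.

Lemma edge_par v : v != r -> e v (par v).
Proof. by move=> vr; rewrite edgeE vr eqxx. Qed.

Lemma dep_par v : dep (par v) = (dep v).-1.
Proof.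
by have [->|/depS->//] := eqVneq v r; rewrite par_root dep_root.
Qed.

Lemma par_neq v : v != r -> par v != v.
Proof. by move/depS => h; apply/eqP => E; move: h; rewrite E => /eqP; rewrite ltn_eqF. Qed.

Lemma dep_eq0 v : (dep v == 0) = (v == r).
Proof.
by apply/idP/eqP => [|->]; [apply: contraTeq => /depS-> | rewrite dep_root].
Qed.

Lemma dep_gt0 v : (0 < dep v) = (v != r).
Proof. by rewrite lt0n dep_eq0. Qed.

Lemma dep_iter k v : dep (iter k par v) = dep v - k.
Proof. by elim: k => [|k IH] /=; rewrite ?subn0 // dep_par IH subnS. Qed.

Lemma iter_dep v : iter (dep v) par v = r.
Proof. by apply/eqP; rewrite -dep_eq0 dep_iter subnn. Qed.

Lemma iter_root k : iter k par r = r.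
Proof. by elim: k => //= k ->; rewrite par_root. Qed.

(** The ancestor relation, reflexive: [y] is reached from [v] by climbing the
difference of depths. *)
Definition anc y v := iter (dep v - dep y) par v == y.

Lemma anc_refl v : anc v v.
Proof. by rewrite /anc subnn. Qed.

Lemma anc_dep y v : anc y v -> dep y <= dep v.
Proof. by move/eqP=> <-; rewrite dep_iter; lia. Qed.

Lemma anc_iter k v : anc (iter k par v) v.
Proof.
rewrite /anc dep_iter; have [kd|/ltnW dk] := leqP k (dep v); first by rewrite subKn.
have -> : dep v - k = 0 by lia.
by rewrite subn0 -(subnKC dk) addnC iterD iter_dep iter_root.
Qed.

Lemma anc_at k v : k <= dep v -> exists2 y, anc y v & dep y = k.
Proof.
by move=> kd; exists (iter (dep v - k) par v); rewrite ?anc_iter // dep_iter subKn.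
Qed.

Lemma anc_eq y y' v : anc y v -> anc y' v -> dep y = dep y' -> y = y'.
Proof. by move=> /eqP a /eqP a' E; move: a; rewrite E a'. Qed.

Lemma anc_trans y v u : anc y v -> anc v u -> anc y u.
Proof. by move=> /eqP yv /eqP vu; rewrite -yv -vu -iterD anc_iter. Qed.

Lemma anc_comp y y' v : anc y v -> anc y' v -> dep y <= dep y' -> anc y y'.
Proof.
move=> a a' le; have [z az dz] := anc_at le.
by rewrite (@anc_eq y z v) // (anc_trans az a').
Qed.

Lemma anc_par v : anc (par v) v. Proof. exact: (anc_iter 1). Qed.

Lemma anc_root v : anc r v.
Proof. by rewrite -(iter_dep v) anc_iter. Qed.

Lemma ancE y v : v != r -> anc y v = (y == v) || anc y (par v).
Proof.
move=> vr; apply/idP/orP => [a|[/eqP->|a]]; last 2 first.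
- exact: anc_refl.
- exact: anc_trans a (anc_par v).
have := anc_dep a; rewrite leq_eqVlt => /orP[/eqP d|d].
  by left; apply/eqP; apply: anc_eq a (anc_refl v) d.
by right; apply: anc_comp a (anc_par v) _; rewrite dep_par -ltnS prednK // (leq_trans _ d).
Qed.

Lemma anc_of_root y : anc y r = (y == r).
Proof.
apply/idP/eqP => [a|->]; last exact: anc_refl.
by apply: (anc_eq a (anc_refl r)); have := anc_dep a; rewrite dep_root; lia.
Qed.

Definition upset (S : {set 'I_n}) := (r \in S) && [forall v in S, par v \in S].

Lemma upsetP (S : {set 'I_n}) : reflect (r \in S /\ forall v, v \in S -> par v \in S) (upset S).
Proof.
by apply: (iffP andP) => -[rS h]; split=> //; [move=> v vS; apply: (forall_inP h) | apply/forall_inP].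
Qed.

Lemma upset_anc S y v : upset S -> v \in S -> anc y v -> y \in S.
Proof.
move=> /upsetP[_ uS] vS /eqP <-.
by elim: (_ - _) => //= k IH; apply: uS.
Qed.

Lemma upset_root S : upset S -> r \in S. Proof. by case/andP. Qed.

Definition induced (S : {set 'I_n}) :=
  [set ab : 'I_n * 'I_n | [&& e ab.1 ab.2, ab.1 \in S & ab.2 \in S]].

Lemma upset_subtree S : upset S -> subtree e (S, induced S).
Proof.
move=> /upsetP[rS uS]; apply/andP; split.
  apply/forallP=> x; apply/forallP=> y; apply/implyP.
  by rewrite !inE /= [e y x]edge_sym => /and3P[-> -> ->].
have cr x : x \in S -> connect (fun a b => (a, b) \in induced S) x r.
  elim: {x}(dep x) {-2}x (leqnn (dep x)) => [|k IH] x.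
    by rewrite leqn0 dep_eq0 => /eqP->.
  move=> dx xS; have [->|xr] := eqVneq x r; first exact: connect0.
  apply: (connect_trans (y := par x)).
    by apply: connect1; rewrite inE /= edge_par // xS uS.
  by apply: IH; [rewrite dep_par; lia | apply: uS].
have sy : connect_sym (fun a b => (a, b) \in induced S).
  apply: sym_connect_sym => a b; rewrite !inE /= edge_sym.
  by case: (e b a) => //=; rewrite andbC.
apply/forall_inP=> x xS; apply/forall_inP=> y yS.
by apply: connect_trans (cr x xS) _; rewrite sy cr.
Qed.

(** The only edge that leaves the set of descendants of [v] is the one to its
parent, so a connected subgraph containing [v] and the root contains that edge.
In particular a subtree through the root is determined by its vertices. *)
Lemma subtree_upset G : subtree e G -> r \in G.1 ->
  upset G.1 /\ G.2 = induced G.1.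
Proof.
case: G => S F /andP[/= /forallP sg /forall_inP cn] rS.
have sF x y : (x, y) \in F -> [&& e x y, x \in S, y \in S & (y, x) \in F].
  by move: (sg x) => /forallP/(_ y)/implyP.
have key v : v \in S -> v != r -> (v, par v) \in F.
  move=> vS vr; have /connectP[p pp lp] := forall_inP (cn v vS) r rS.
  have : ~~ anc v r by rewrite anc_of_root.
  rewrite lp; have : anc v v := anc_refl v.
  move: pp {lp}; move: {1 3 5}v => w.
  elim: p w => [|x p IH] w /=; first by move=> _ ->.
  case/andP=> wx pp avw nl.
  have [avx|navx] := boolP (anc v x); first exact: IH pp avx nl.
  have /and4P[ewx _ _ _] := sF _ _ wx.
  move: ewx; rewrite edgeE => /orP[/andP[wr /eqP px]|/andP[xr /eqP pw]].
    move: avw; rewrite ancE // px (negPf navx) orbF => /eqP ->.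
    by rewrite px.
  by move: navx; rewrite ancE // pw avw orbT.
have pS v : v \in S -> par v \in S.
  move=> vS; have [->|vr] := eqVneq v r; first by rewrite par_root.
  by have /and4P[] := sF _ _ (key v vS vr).
split; first exact/upsetP.
apply/setP=> -[a b]; rewrite inE /=; apply/idP/and3P => [/sF/and4P[]//|[eab aS bS]].
move: eab; rewrite edgeE => /orP[/andP[ar /eqP <-]|/andP[br /eqP <-]]; first exact: key.
by have /and4P[] := sF _ _ (key b bS br).
Qed.

Lemma subtree_number_root u :
  subtree_number e r u = #|[set S | upset S && (u \in S)]|.
Proof.
rewrite /subtree_number -(card_in_imset (f := fst)).
  apply: eq_card => S; rewrite inE; apply/imsetP/andP => [[G]|[uS us]].
    by rewrite inE => /and3P[sG rG uG] ->; split=> //; case: (subtree_upset sG rG).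
  by exists (S, induced S); rewrite // inE upset_subtree //= us upset_root.
move=> [S F] [S' F']; rewrite !inE /= => /and3P[sG rG _] /and3P[sG' rG' _] E.
have [_ /= ->] := subtree_upset sG rG; have [_ /= ->] := subtree_upset sG' rG'.
by rewrite E.
Qed.

Lemma upsets_le_subtree_number v w :
  #|[set S | [&& upset S, v \in S & w \in S]]| <= subtree_number e v w.
Proof.
rewrite /subtree_number -(card_imset (f := fun S => (S, induced S))) //.
  apply: subset_leq_card; apply/subsetP=> G /imsetP[S].
  rewrite !inE => /and3P[uS vS wS] -> /=; by rewrite upset_subtree //= vS wS.
by move=> S S' [].
Qed.

Lemma subtree_number_anc y w : anc y w -> subtree_number e r w <= subtree_number e y w.
Proof.
move=> a; apply: subset_leq_card; apply/subsetP=> G; rewrite !inE.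
move=> /and3P[sG rG wG]; rewrite sG wG /= andbT.
by have [uS _] := subtree_upset sG rG; apply: upset_anc a.
Qed.

End Rooted.

(** * Counting subtrees through a core vertex *)

Local Open Scope nat_scope.

Section SubtreeRatios.
Variables (n : nat) (e : rel 'I_n) (r : 'I_n) (par : 'I_n -> 'I_n).
Variable dep : 'I_n -> nat.
Hypothesis rt : rooted e r par dep.
Local Notation anc := (anc par dep).
Local Notation upset := (upset r par).

Definition ancs u := [set v | anc v u].

Lemma card_ancs u : #|ancs u| = (dep u).+1.
Proof.
rewrite -(card_ord (dep u).+1) -cardsT.
rewrite -(card_in_imset (f := fun v => inord (dep v) : 'I_(dep u).+1) (D := ancs u)).
  congr #|pred_of_set _|; apply/setP=> k; rewrite inE; apply/imsetP.
  have [|y ay dy] := anc_at rt (k := k) (v := u); first by rewrite -ltnS.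
  by exists y; rewrite ?inE // dy inord_val.
move=> v w; rewrite !inE => av aw /(congr1 val) /=.
by rewrite !inordK ?ltnS ?(anc_dep rt) //; apply: anc_eq av aw.
Qed.

(** A parent-closed set meets the path from the root to [u] in an initial
segment; this is the depth at which the segment ends. *)
Definition reach (S : {set 'I_n}) u := \max_(v in S | anc v u) dep v.

Lemma reach_le S u : reach S u <= dep u.
Proof. by apply/bigmax_leqP => v /andP[_ a]; apply: (anc_dep rt a). Qed.

Lemma mem_reach S u v : upset S -> anc v u -> (v \in S) = (dep v <= reach S u).
Proof.
move=> uS av; apply/idP/idP => [vS|].
  by apply: (leq_bigmax_cond (F := dep)); rewrite vS av.
move=> le; have rS := upset_root uS.
have [|w /andP[wS aw] ew] := eq_bigmax_cond (A := fun v => (v \in S) && anc v u) dep.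
  by apply/card_gt0P; exists r; rewrite unfold_in rS (anc_root rt).
move: le; rewrite /reach ew => le.
by apply: upset_anc uS wS _; apply: (anc_comp rt av aw le).
Qed.

Lemma upset_ancs u : upset (ancs u).
Proof.
apply/upsetP; split=> [|v]; rewrite !inE; first exact: anc_root rt _.
by apply: (anc_trans rt (anc_par rt v)).
Qed.

Lemma upsetU S S' : upset S -> upset S' -> upset (S :|: S').
Proof.
move=> /upsetP[a b] /upsetP[_ d]; apply/upsetP; rewrite inE a; split=> // v.
by rewrite !inE => /orP[/b->//|/d->]; rewrite orbT.
Qed.

(** Adding to a parent-closed set the whole path to [w] is injective once the
depth at which the set leaves the path is recorded, and there are
[dep w + 1] such depths. *)
Lemma card_upsets_le x w :
  #|[set S | upset S && (x \in S)]| <=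
  (dep w).+1 * #|[set S | [&& upset S, x \in S & w \in S]]|.
Proof.
set X := [set S | _]; set Xw := [set S | _].
pose F (S : {set 'I_n}) := (S :|: ancs w, inord (reach S w) : 'I_(dep w).+1).
rewrite -(card_in_imset (f := F)).
  rewrite mulnC -[X in _ * X]card_ord -cardsT -cardsX; apply: subset_leq_card.
  apply/subsetP=> _ /imsetP[S + ->]; rewrite !inE andbT /= => /andP[uS ->].
  by rewrite upsetU ?upset_ancs // (anc_refl par dep) orbT.
move=> S S'; rewrite !inE => /andP[uS _] /andP[uS' _] [eU /(congr1 val)] /=.
rewrite !inordK ?ltnS ?reach_le // => eR; apply/setP=> v.
have [av|nav] := boolP (anc v w); first by rewrite (mem_reach uS av) (mem_reach uS' av) eR.
by move/setP: eU => /(_ v); rewrite !inE (negPf nav) !orbF.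
Qed.

Variables (x u : 'I_n).
Hypothesis (xr : x != r) (px : par x = r) (axu : anc x u).
Hypothesis leaf : forall v, v != r -> par v != u.
Hypothesis du : 1 < dep u.

Let B := [set v | anc x v].
Let Q := B :\: ancs u.
Let X := [set S | upset S && (x \in S)].
Let Xu := [set S | [&& upset S, x \in S & u \in S]].
Let cls j := [set S in X | reach S u == j].

Lemma dep_child : dep x = 1.
Proof. by rewrite (depS rt xr) px (dep_root rt). Qed.

Lemma anc_outside_branch v : v \notin B -> anc v u -> v = r.
Proof.
rewrite inE => nv av; apply/eqP; rewrite -(dep_eq0 rt) -leqn0 leqNgt -dep_child.
by apply: contra nv => h; apply: (anc_comp rt axu av h).
Qed.

Definition truncate j (S : {set 'I_n}) :=
  (S :\: B) :|: [set v | anc v u && (dep v <= j)].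

Lemma truncate_cls j S : 0 < j -> j <= dep u -> S \in Xu -> truncate j S \in cls j.
Proof.
move=> j0 ju; rewrite !inE => /and3P[uS _ _].
have /upsetP[rS pS] := uS.
rewrite axu dep_child j0 orbT andbT; apply/andP; split.
  apply/upsetP; split; first by rewrite !inE (anc_of_root rt) (negPf xr) rS.
  move=> v; rewrite !inE => /orP[/andP[nb vS]|/andP[a d]].
    rewrite pS // andbT; apply/orP; left; apply: contra nb => h.
    by apply: (anc_trans rt h (anc_par rt v)).
  by rewrite (anc_trans rt (anc_par rt v) a) (dep_par rt) (leq_trans (leq_pred _) d) orbT.
rewrite eqn_leq; apply/andP; split.
  apply/bigmax_leqP => v; rewrite !inE => /andP[/orP[/andP[nb _]|/andP[] //] a].
  by rewrite (anc_outside_branch _ a) ?inE // (dep_root rt).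
have [y ay dy] := anc_at rt ju; rewrite -dy.
by apply: (leq_bigmax_cond (F := dep)); rewrite !inE ay /= dy leqnn orbT.
Qed.

(** A parent-closed set containing [u] contains the path to [u]; hence it is
recovered from its truncation and its trace on the vertices of the branch that
lie off that path. *)
Lemma card_cls j : 0 < j -> j <= dep u -> #|Xu| <= 2 ^ #|Q| * #|cls j|.
Proof.
move=> j0 ju; pose F S := (truncate j S, S :&: Q).
rewrite -(card_in_imset (f := F) (D := Xu)).
  rewrite mulnC -card_powerset -cardsX; apply: subset_leq_card.
  apply/subsetP=> _ /imsetP[S SX ->].
  by rewrite inE truncate_cls //= powersetE subsetIr.
move=> S S'; rewrite !inE => /and3P[uS xS uuS] /and3P[uS' xS' uuS'] [/setP eT /setP eQ].
apply/setP=> v; have [vB|vB] := boolP (v \in B); last first.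
  have [av|nav] := boolP (anc v u).
    by rewrite (anc_outside_branch vB av) (upset_root uS) (upset_root uS').
  by move: (eT v); rewrite !inE (negPf nav) !orbF; move: vB; rewrite inE => ->.
have [av|nav] := boolP (anc v u).
  by rewrite (upset_anc uS uuS av) (upset_anc uS' uuS' av).
by move: (eQ v); move: vB; rewrite !inE nav => ->; rewrite !andbT.
Qed.

Lemma card_cls_last : #|Xu| <= #|cls (dep u)|.
Proof.
apply: subset_leq_card; apply/subsetP=> S; rewrite !inE => /and3P[uS -> uu].
rewrite uS /= eqn_leq reach_le /=.
by rewrite -(mem_reach uS (anc_refl par dep u)).
Qed.

(** As [u] is a leaf, it can be removed from a parent-closed set. *)
Lemma card_cls_penult : #|Xu| <= #|cls (dep u).-1|.
Proof.
have ur : u != r by rewrite -(dep_gt0 rt) ltnW.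
rewrite -(card_in_imset (f := fun S => S :\ u) (D := Xu)).
  apply: subset_leq_card; apply/subsetP=> _ /imsetP[S + ->].
  rewrite !inE => /and3P[uS xS uu]; have /upsetP[rS pS] := uS.
  have xu : x != u by apply: contraTneq du => <-; rewrite dep_child.
  rewrite xu xS !andbT; apply/andP; split.
    apply/upsetP; split; first by rewrite !inE eq_sym ur.
    move=> v; rewrite !inE => /andP[vu vS]; rewrite pS // andbT.
    by have [->|/leaf//] := eqVneq v r; rewrite (par_root rt) eq_sym.
  rewrite eqn_leq; apply/andP; split.
    apply/bigmax_leqP => v; rewrite !inE => /andP[/andP[vu vS] a].
    have := anc_dep rt a; rewrite leq_eqVlt => /orP[/eqP d|]; last by move=> h; rewrite -ltnS (ltn_predK du).
    by rewrite (anc_eq a (anc_refl par dep u) d) eqxx in vu.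
  rewrite -(dep_par rt); apply: (leq_bigmax_cond (F := dep)).
  by rewrite !inE pS // leaf // (anc_par rt).
move=> S S'; rewrite !inE => /and3P[_ _ uS] /and3P[_ _ uS'] E.
by rewrite -(setD1K uS) E setD1K.
Qed.

(** Sort the sets containing [x] by the depth at which they leave the path to
[u].  The two deepest classes are at least as large as the family of sets
containing [u], and each of the others at least as large up to a factor
[2 ^ #|Q|]. *)
Lemma card_upsets_ge :
  (2 ^ #|Q|.+1 + (dep u - 2)) * #|Xu| <= 2 ^ #|Q| * #|X|.
Proof.
have -> : #|X| = \sum_(j < (dep u).+1) #|cls j|.
  rewrite -sum1_card (partition_big (fun S => inord (reach S u) : 'I_(dep u).+1) predT) //=.
  apply: eq_bigr => j _; rewrite -sum1_card; apply: eq_bigl => S.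
  by rewrite [RHS]inE -val_eqE /= inordK // ltnS reach_le.
have [l dl] : exists l, dep u = l.+2 by exists (dep u - 2); lia.
have c1 := card_cls_last; have c2 := card_cls_penult.
have c3 : \sum_(j < l) #|Xu| <= \sum_(j < l) 2 ^ #|Q| * #|cls j.+1|.
  apply: leq_sum => j _; apply: card_cls => //; rewrite dl.
  by have := ltn_ord j; lia.
move: c1 c2 c3; rewrite sum_nat_const card_ord -big_distrr /= dl /= => c1 c2 c3.
rewrite big_ord_recr big_ord_recr big_ord_recl /= !subSS subn0 expnS.
set s := \sum_(i < l) _; have -> : s = \sum_(i < l) #|cls i.+1|.
  by apply: eq_bigr => i _; rewrite /bump.
move: c1 c2 c3; set s' := \sum_(i < l) _; set q := 2 ^ _ => c1 c2 c3.
have {}c1 : q * #|Xu| <= q * #|cls l.+2| by rewrite leq_mul.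
have {}c2 : q * #|Xu| <= q * #|cls l.+1| by rewrite leq_mul.
rewrite !mulnDr mulnDl -mulnA mul2n -addnn.
move: c1 c2 c3; move: (q * _) (q * _) (q * _) (q * _) (l * _) => a b c d f.
lia.
Qed.

Lemma card_branch : #|B| = dep u + #|Q|.
Proof.
rewrite -(cardsID (ancs u) B); congr (_ + _).
apply/eqP; rewrite -eqSS -card_ancs (cardsD1 r (ancs u)) inE (anc_root rt) add1n eqSS.
apply/eqP; apply: eq_card => v; rewrite !inE.
apply/andP/andP => -[a b]; split => //.
  by apply: contraTneq a => ->; rewrite (anc_of_root rt).
by apply: contraNT a => h; apply/eqP; apply: anc_outside_branch; rewrite ?inE.
Qed.

End SubtreeRatios.

Lemma eccentric_le n (e : rel 'I_n) v u :
  eccentric_subtree_number e v <= subtree_number e v u.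
Proof.
rewrite /eccentric_subtree_number; have : u \in index_enum 'I_n by rewrite mem_index_enum.
elim: (index_enum _) => // a s IH; rewrite big_cons inE => /orP[/eqP->|/IH h].
  exact: geq_minl.
by rewrite (leq_trans (geq_minr _ _)).
Qed.

Lemma eccentric_attained n (e : rel 'I_n) v :
  exists w, eccentric_subtree_number e v = subtree_number e v w.
Proof.
rewrite /eccentric_subtree_number; elim: (index_enum _) => [|a s [w IH]].
  by rewrite big_nil; exists v.
by rewrite big_cons IH; case: (leqP (subtree_number e v a) (subtree_number e v w)) => h;
  [exists a | exists w].
Qed.

Lemma core_center_ltn n (e : rel 'I_n) c x : c \in core_center e ->
  x \notin core_center e -> eccentric_subtree_number e x < eccentric_subtree_number e c.
Proof.
rewrite !inE => /forallP cM; rewrite negb_forall => /existsP[w].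
by rewrite -ltnNge => h; apply: leq_trans h (cM w).
Qed.

Section CoreBranch.
Variables (n : nat) (e : rel 'I_n) (r : 'I_n) (par : 'I_n -> 'I_n).
Variable dep : 'I_n -> nat.
Hypothesis rt : rooted e r par dep.
Local Notation anc := (anc par dep).
Local Notation upset := (upset r par).
Variables (x u : 'I_n).
Hypothesis (xr : x != r) (px : par x = r) (axu : anc x u).
Hypothesis leaf : forall v, v != r -> par v != u.
Hypothesis du : 1 < dep u.
Hypothesis ecc : eccentric_subtree_number e x < eccentric_subtree_number e r.

(** At a descendant [w] of [x] the root has at most as many subtrees as [x],
so the minimum for [x] is attained outside the branch of [x].  Then the sets
through [x] that reach [w] are fewer than those that reach [u], and the two
estimates of their proportions must be compatible. *)
Lemma core_branch_ratio :
  exists w, [/\ ~~ anc x w, 1 < dep w &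
   dep u - 1 <= (dep w).-1 * 2 ^ #|[set v | anc x v] :\: ancs par dep u| ].
Proof.
have [w ew] := eccentric_attained e x.
have nw : ~~ anc x w.
  apply: contraTN ecc => a; rewrite -leqNgt ew.
  exact: leq_trans (eccentric_le e r w) (subtree_number_anc rt a).
exists w.
have := card_upsets_le rt x w.
have := card_upsets_ge rt xr px axu leaf du.
set q := #|_ :\: _|.
have : #|[set S | [&& upset S, x \in S & w \in S]]| <
       #|[set S | [&& upset S, x \in S & u \in S]]|.
  apply: leq_ltn_trans (upsets_le_subtree_number rt x w) _.
  rewrite -ew; apply: leq_trans ecc _; apply: leq_trans (eccentric_le e r u) _.
  rewrite (subtree_number_root rt); apply: subset_leq_card; apply/subsetP=> S.
  by rewrite !inE => /andP[uS uu]; rewrite uS uu (upset_anc uS uu axu).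
set Xw := #|[set S | [&& upset S, x \in S & w \in S]]|.
set Xu := #|[set S | [&& upset S, x \in S & u \in S]]|.
set X := #|[set S | upset S && (x \in S)]|.
move=> h1 h2 h3.
have Q0 : 0 < 2 ^ q by rewrite expn_gt0.
have h4 : (2 ^ q.+1 + (dep u - 2)) * Xu < 2 ^ q * (dep w).+1 * Xu.
  apply: leq_ltn_trans h2 _; rewrite -mulnA ltn_pmul2l //.
  by apply: leq_ltn_trans h3 _; rewrite ltn_pmul2l.
have {}h4 : 2 ^ q.+1 + (dep u - 2) < 2 ^ q * (dep w).+1.
  by move: h4; rewrite ltn_mul2r => /andP[].
move: h4; rewrite expnS.
case: (dep w) => [|[|h]]; rewrite ?muln1 /=; [lia | lia |].
move: (2 ^ q) Q0 => Q Q0 h4; split=> //.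
have : Q * h.+3 = Q * 2 + h.+1 * Q by rewrite -addn2 addnC mulnDr [h.+1 * Q]mulnC.
by lia.
Qed.

(** With [h = dep w] and [k] off-path vertices the previous inequality reads
[dep u - 1 <= (h - 1) * 2 ^ k], and [h - 1 <= 2 ^ (h - 2)]: deepening the side
of [w] by one vertex helps no more than one additional pendant vertex does.
Hence [n - 2 - dep u] satisfies the inequality of which [g0] is the least
solution. *)
Lemma core_branch_size g0 :
  (forall g : nat, 0 < g -> n - 3 <= 2 ^ (g - 1) + g -> g0 <= g) ->
  exists w, [/\ ~~ anc x w, 1 < dep w & dep u + 2 + g0 <= n].
Proof.
move=> gmin; have [w [nw dw le]] := core_branch_ratio.
exists w; split => //.
move: le; set q := #|_ :\: _| => le.
have cB := card_branch rt xr px axu; rewrite -/q in cB.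
have cA : (dep w).+1 <= #|~: [set v | anc x v]|.
  rewrite -(card_ancs rt w); apply: subset_leq_card; apply/subsetP=> v.
  by rewrite !inE => a; apply: contra nw => b; apply: (anc_trans rt b a).
have := cardsC [set v | anc x v]; rewrite card_ord cB.
move: #|~: _| cA => A cA nE {cB}.
have dB : (dep w).-1 <= 2 ^ (dep w - 2).
  case: (dep w) dw => [|[|h]] //= _; rewrite !subSS subn0.
  exact: ltn_expl.
have [k Ak] : exists k, A = (dep w).+1 + k by exists (A - (dep w).+1); lia.
(* the number of vertices left for pendant vertices on a path-star tree whose
   path is as long as the comparison below requires *)
pose G := n - 2 - dep u.
have GE : G - 1 = (dep w - 2) + q + k by rewrite /G; lia.
have G0 : 0 < G by rewrite /G; lia.
suff : g0 <= G by rewrite /G; lia.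
apply: gmin => //; rewrite GE.
have : dep u - 1 <= 2 ^ (dep w - 2 + q + k).
  apply: leq_trans le _; rewrite !expnD; apply: leq_trans (leq_mul dB (leqnn _)) _.
  by rewrite leq_pmulr // expn_gt0.
by move: (2 ^ _) => P; rewrite /G; lia.
Qed.
End CoreBranch.

(** * The second smallest Laplacian eigenvalue *)

Local Open Scope ring_scope.

Lemma complex_Re_sum (R : realType) (I : finType) (F : I -> R[i]) :
  complex.Re (\sum_i F i) = \sum_i complex.Re (F i).
Proof.
by elim/big_rec2: _ => // i x y _ <-; case: (F i) => a b; case: y.
Qed.
Lemma complex_Im_sum (R : realType) (I : finType) (F : I -> R[i]) :
  complex.Im (\sum_i F i) = \sum_i complex.Im (F i).
Proof.
by elim/big_rec2: _ => // i x y _ <-; case: (F i) => a b; case: y.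
Qed.

(** The spectral theorem for complex normal matrices, applied to a
real symmetric matrix; the eigenvalues are real. *)
Lemma real_symmetric_unitary_diag (R : realType) n (A : 'M[R]_n) : A^T = A ->
  exists (P : 'M[R[i]]_n) (d : 'I_n -> R),
  [/\ forall i j, \sum_k P i k * (P j k)^*%C = (i == j)%:R,
      forall j k, \sum_i (P i j)^*%C * P i k = (j == k)%:R,
      forall i j, \sum_k P i k * (A k j)%:C%C = (d i)%:C%C * P i j
    & char_poly A = \prod_(i < n) ('X - (d i)%:P)].
Proof.
move=> symA.
pose B : 'M[R[i]]_n := map_mx (real_complex R) A.
have hB : B \is hermsymmx.
  apply: realsym_hermsym.
    apply/is_hermitianmxP; rewrite expr0 scale1r map_mx_id //.
    by apply/matrixP=> i j; rewrite !mxE -[in LHS]symA mxE.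
  by apply/mxOverP=> i j; rewrite mxE complex_real.
have /hermitian_normalmx/orthomx_spectralP := hB.
have dreal := hermitian_spectral_diag_real hB.
have := spectral_unitarymx B.
set P := spectralmx B; set sp := spectral_diag B => uP eB.
exists P, (fun i => complex.Re (sp 0 i)).
have spE i : (complex.Re (sp 0 i))%:C%C = sp 0 i.
  by apply: RRe_real; apply: (mxOverP dreal).
have PPt := unitarymxP uP.
have PtP := mulmx1C PPt.
have PB : P *m B = diag_mx sp *m P.
  by rewrite eB !mulmxA mulmxV ?mul1mx ?unitarymx_unit.
split.
- move=> i j; move/matrixP: PPt => /(_ i j); rewrite !mxE => <-.
  by apply: eq_bigr => k _; rewrite !mxE.
- move=> j k; move/matrixP: PtP => /(_ j k); rewrite !mxE => <-.
  by apply: eq_bigr => i _; rewrite !mxE.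
- move=> i j; move/matrixP: PB => /(_ i j); rewrite !mxE spE => e.
  transitivity (\sum_k P i k * B k j); first by apply: eq_bigr => k _; rewrite !mxE.
  rewrite e (bigD1 i) //= mxE eqxx mulr1n big1 ?addr0 // => k ki.
  by rewrite mxE eq_sym (negPf ki) mulr0n mul0r.
- apply: (map_poly_inj (real_complex R)); rewrite map_char_poly -/B.
  have -> : char_poly B = char_poly (diag_mx sp).
    have : \det (map_mx polyC P) * char_poly B =
           \det (map_mx polyC P) * char_poly (diag_mx sp).
      rewrite [RHS]mulrC -!det_mulmx; congr (\det _).
      rewrite mulmxBr mulmxBl -!map_mxM PB; congr (_ - _).
      by rewrite scalar_mxC.
    apply: mulfI; rewrite det_map_mx polyC_eq0.
    by have := unitarymx_unit uP; rewrite unitmxE unitfE.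
  rewrite (char_poly_trig (diag_mx_is_trig sp)) rmorph_prod /=.
  apply: eq_bigr => i _; rewrite rmorphB /= map_polyX map_polyC /=.
  by rewrite spE mxE eqxx.
Qed.

(** Real and imaginary parts of a unitary eigenbasis.  The [2n] real vectors
[u i], [w i] are eigenvectors satisfying a Parseval identity, which is all
that is needed to diagonalise quadratic forms without constructing a real
orthonormal eigenbasis. *)
Lemma real_symmetric_frame (R : realType) n (A : 'M[R]_n) : A^T = A ->
  exists (u w : 'I_n -> 'I_n -> R) (d : 'I_n -> R),
  [/\ forall i j, \sum_k (u i k * u j k + w i k * w j k) = (i == j)%:R
                  /\ \sum_k (w i k * u j k - u i k * w j k) = 0,
      forall j k, \sum_i (u i j * u i k + w i j * w i k) = (j == k)%:R,
      forall i j, \sum_k u i k * A k j = d i * u i j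
                  /\ \sum_k w i k * A k j = d i * w i j
    & char_poly A = \prod_(i < n) ('X - (d i)%:P)].
Proof.
move=> /real_symmetric_unitary_diag[P [d [PPt PtP PA cA]]].
exists (fun i k => complex.Re (P i k)), (fun i k => complex.Im (P i k)), d.
split => //.
- move=> i j; have := PPt i j.
  move=> /[dup] /(congr1 (@complex.Re R)) + /(congr1 (@complex.Im R)).
  rewrite complex_Re_sum complex_Im_sum => eR eI; split.
    transitivity (complex.Re ((i == j)%:R : R[i])); last by case: (i == j).
    rewrite -eR; apply: eq_bigr => k _.
    by case: (P i k) (P j k) => [a b] [a' b'] /=; ring.
  transitivity (complex.Im ((i == j)%:R : R[i])); last by case: (i == j).
  rewrite -eI; apply: eq_bigr => k _.
  by case: (P i k) (P j k) => [a b] [a' b'] /=; ring.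
- move=> j k; have := PtP j k => /(congr1 (@complex.Re R)).
  rewrite complex_Re_sum => eR.
  transitivity (complex.Re ((j == k)%:R : R[i])); last by case: (j == k).
  rewrite -eR; apply: eq_bigr => i _.
  by case: (P i j) (P i k) => [a b] [a' b'] /=; ring.
- move=> i j; have := PA i j.
  move=> /[dup] /(congr1 (@complex.Re R)) + /(congr1 (@complex.Im R)).
  rewrite complex_Re_sum complex_Im_sum => eR eI; split.
    transitivity (complex.Re ((d i)%:C%C * P i j)).
      by rewrite -eR; apply: eq_bigr => k _; case: (P i k) => a b /=; ring.
    by case: (P i j) => a b /=; ring.
  transitivity (complex.Im ((d i)%:C%C * P i j)).
    by rewrite -eI; apply: eq_bigr => k _; case: (P i k) => a b /=; ring.
  by case: (P i j) => a b /=; ring.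
Qed.

(** The Laplacian acting on functions on the vertices. *)
Definition lap (R : realType) n (e : rel 'I_n) (f : 'I_n -> R) (v : 'I_n) : R :=
  \sum_u (e v u)%:R * (f v - f u).

Definition energy (R : realType) n (e : rel 'I_n) (f : 'I_n -> R) : R :=
  \sum_v f v * lap e f v.

Lemma lap_mx (R : realType) n (e : rel 'I_n) (f : 'I_n -> R) v :
  lap e f v = \sum_j laplacian R e v j * f j.
Proof.
rewrite /lap; under eq_bigr do rewrite mulrBr.
rewrite sumrB -mulr_suml.
under [RHS]eq_bigr do rewrite !mxE mulrBl.
rewrite sumrB; congr (_ - _).
rewrite [in RHS](bigD1 v) //= eqxx mulr1n [X in _ = _ + X]big1 ?addr0.
  congr (_ * _); rewrite -sum1_card natr_sum [in RHS]big_mkcond /=.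
  by apply: eq_bigr => j _; rewrite inE; case: (e v j).
by move=> j jv; rewrite eq_sym (negPf jv) mul0r.
Qed.

Lemma laplacian_mulE (R : realType) n (e : rel 'I_n) (Y : 'cV[R]_n) v :
  (laplacian R e *m Y) v 0 = lap e (fun w => Y w 0) v.
Proof. by rewrite lap_mx mxE. Qed.

Lemma laplacian_sym (R : realType) n (e : rel 'I_n) : symmetric e ->
  (laplacian R e)^T = laplacian R e.
Proof.
move=> se; apply/matrixP=> i j; rewrite !mxE se eq_sym.
by case: eqP => [->|].
Qed.

Section SecondEigenvalue.
Variables (R : realType) (n : nat) (e : rel 'I_n).
Hypothesis n_gt1 : (1 < n)%N.
Hypothesis se : symmetric e.
Hypothesis energy_ge0 : forall f : 'I_n -> R, 0 <= energy e f.
Hypothesis energy_eq0 : forall f : 'I_n -> R,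
  energy e f <= 0 -> forall v w, f v = f w.

Let dot (f g : 'I_n -> R) := \sum_v f v * g v.

Lemma lap_selfadjoint (f g : 'I_n -> R) : dot f (lap e g) = dot (lap e f) g.
Proof.
rewrite /dot; under eq_bigr do rewrite lap_mx mulr_sumr.
rewrite exchange_big; apply: eq_bigr => j _; rewrite lap_mx mulr_suml.
apply: eq_bigr => i _; rewrite -{1}(laplacian_sym R se) mxE; ring.
Qed.

Lemma laplacian_frame :
  exists (u w : 'I_n -> 'I_n -> R) (d : 'I_n -> R),
  [/\ forall i j, dot (u i) (u j) + dot (w i) (w j) = (i == j)%:R
                  /\ dot (w i) (u j) = dot (u i) (w j),
      forall f g, dot f g = \sum_i (dot (u i) f * dot (u i) g
                                    + dot (w i) f * dot (w i) g),
      forall i, lap e (u i) =1 (fun v => d i * u i v)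
                  /\ lap e (w i) =1 (fun v => d i * w i v)
    & char_poly (laplacian R e) = \prod_(i < n) ('X - (d i)%:P)].
Proof.
have [u [w [d [h1 h2 h3 h4]]]] := real_symmetric_frame (laplacian_sym R se).
exists u, w, d; split => //.
- move=> i j; have [a b] := h1 i j; split.
    by rewrite -a big_split.
  by move/eqP: b; rewrite sumrB subr_eq0 => /eqP.
- move=> f g.
  transitivity (\sum_j \sum_k f j * g k * (j == k)%:R).
    apply: eq_bigr => j _; rewrite (bigD1 j) //= eqxx mulr1 big1 ?addr0 // => k kj.
    by rewrite eq_sym (negPf kj) mulr0.
  under eq_bigr => j _ do (under eq_bigr => k _ do rewrite -h2 mulr_sumr).
  under eq_bigr => j _ do rewrite exchange_big.
  rewrite exchange_big; apply: eq_bigr => i _.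
  rewrite /dot !mulr_suml -big_split; apply: eq_bigr => j _ /=.
  rewrite !mulr_sumr -big_split; apply: eq_bigr => k _ /=; ring.
- move=> i; split=> v; have [a b] := h3 i v; rewrite lap_mx -?a -?b;
  by apply: eq_bigr => j _; rewrite -{1}(laplacian_sym R se) mxE mulrC.
Qed.

Lemma char_poly_roots_perm (d : 'I_n -> R) s :
  \prod_(i < n) ('X - (d i)%:P) = \prod_(a <- s) ('X - a%:P) ->
  perm_eq s [seq d i | i <- enum 'I_n].
Proof.
move=> h; rewrite perm_sym; apply: prod_XsubC_eq.
by rewrite -h big_map enumT.
Qed.

(** At most one eigenvalue is smaller than [mu], counted with
multiplicity.  If there is one, it is 0, for otherwise the constants would be orthogonal to
the whole frame; its eigenvectors are then constant, and do not contribute to a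
function of zero sum. *)
Lemma second_eigenvalue_rayleigh mu (f : 'I_n -> R) :
  second_smallest_eigenvalue (laplacian R e) mu ->
  \sum_v f v = 0 -> mu * (\sum_v f v ^+ 2) <= energy e f.
Proof.
move=> [s [srt cs mus]] f0.
have [u [w [d [on pars eig cd]]]] := laplacian_frame.
have ps : perm_eq s [seq d i | i <- enum 'I_n] by apply: char_poly_roots_perm; rewrite -cd.
have few i j : d i < mu -> d j < mu -> i = j.
  move=> di dj; apply/eqP; apply: contraT => ij.
  have : (count (fun x => (x < mu)%R) s <= 1)%N.
    case: s srt mus {cs ps} => [|s0 [|s1 s]] //= srt mus.
      by case: (_ < _)%R.
    have {}mus : mu = s1 := mus.
    case/andP: srt => _; rewrite (path_sortedE (@le_trans _ _)) => /andP[al _].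
    rewrite mus ltxx add0n -[X in (_ <= X)%N]addn0 leq_add ?leq_b1 //.
    rewrite leqn0 eqn0Ngt -has_count -all_predC; apply: sub_all al => x /=.
    by rewrite -leNgt.
  rewrite (permP ps) count_map /= leqNgt => /negP[].
  have : [:: i; j] \subset [pred k | d k < mu]%R.
    by apply/subsetP=> k; rewrite !inE => /orP[]/eqP->.
  move/subset_leq_card; rewrite (card_uniqP _) /= ?inE ?ij // => /leq_trans; apply.
  rewrite cardE /enum_mem size_filter -enumT (eq_filter (a2 := predT)) // filter_predT.
  exact: sub_count.
have dotE g : energy e g = \sum_i d i * ((dot (u i) g)^+2 + (dot (w i) g)^+2).
  rewrite /energy -/(dot g (lap e g)) pars; apply: eq_bigr => i _.
  rewrite !lap_selfadjoint /dot.
  have [eu ew] := eig i.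
  under [X in _ * X + _]eq_bigr do rewrite eu -mulrA.
  under [X in _ + _ * X]eq_bigr do rewrite ew -mulrA.
  rewrite -!mulr_sumr; ring.
have nE g : \sum_v g v ^+ 2 = \sum_i ((dot (u i) g)^+2 + (dot (w i) g)^+2).
  transitivity (dot g g); first by apply: eq_bigr => v _; rewrite expr2.
  by rewrite pars; apply: eq_bigr => i _; rewrite !expr2.
have enu i : energy e (u i) = d i * dot (u i) (u i).
  rewrite /energy /dot mulr_sumr; apply: eq_bigr => v _.
  by rewrite (eig i).1; ring.
have enw i : energy e (w i) = d i * dot (w i) (w i).
  rewrite /energy /dot mulr_sumr; apply: eq_bigr => v _.
  by rewrite (eig i).2; ring.
have dge0 i : 0 <= d i.
  have := (on i i).1; rewrite eqxx => o.
  have -> : d i = energy e (u i) + energy e (w i).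
    by rewrite enu enw -mulrDr o mulr1.
  by apply: addr_ge0.
rewrite dotE nE mulr_sumr; apply: ler_sum => i _.
have [di|di] := ltP (d i) mu; last first.
  by apply: ler_wpM2r => //; rewrite addr_ge0 ?sqr_ge0.
have one0 j : d j * dot (u j) (fun=> 1) = 0 /\ d j * dot (w j) (fun=> 1) = 0.
  have l1 : lap e (fun=> 1 : R) =1 fun=> 0.
    by move=> v; rewrite /lap big1 // => k _; rewrite subrr mulr0.
  have [eu ew] := eig j.
  have z g : dot (lap e g) (fun=> 1) = 0.
    by rewrite -lap_selfadjoint /dot big1 // => k _; rewrite l1 mulr0.
  split; [rewrite -(z (u j)) | rewrite -(z (w j))];
   rewrite /dot mulr_sumr; apply: eq_bigr => v _; rewrite ?eu ?ew; ring.
have di0 : d i = 0.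
  apply/eqP; apply: contraT => dn0.
  have : dot (fun=> 1) (fun=> 1) = 0.
    rewrite pars big1 // => j _.
    have dj : d j != 0.
      have [->//|ij] := eqVneq j i.
      have : ~~ (d j < mu) by apply: contra_neqN ij => h; apply: few.
      rewrite -leNgt => h; rewrite gt_eqF //; apply: lt_le_trans h.
      exact: le_lt_trans (dge0 i) di.
    have [/eqP + /eqP] := one0 j; rewrite !mulf_eq0 (negPf dj) /= => /eqP-> /eqP->.
    by rewrite !mul0r addr0.
  rewrite /dot sumr_const card_ord mulr1 => /eqP; rewrite pnatr_eq0.
  by move=> /eqP n0; move: n_gt1; rewrite n0.
have cu : dot (u i) f = 0.
  rewrite /dot; have v0 : 'I_n := i.
  under eq_bigr => v _ do rewrite (@energy_eq0 (u i) _ v i) ?enu ?di0 ?mul0r //.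
  by rewrite -mulr_sumr f0 mulr0.
have cw : dot (w i) f = 0.
  rewrite /dot; have v0 : 'I_n := i.
  under eq_bigr => v _ do rewrite (@energy_eq0 (w i) _ v i) ?enw ?di0 ?mul0r //.
  by rewrite -mulr_sumr f0 mulr0.
by rewrite cu cw !expr2 !mulr0 addr0 !mulr0.
Qed.

(** Positivity: two eigenvalues that are at most 0 would have constant,
hence proportional, eigenvectors, against orthogonality. *)
Lemma second_smallest_exists :
  exists2 mu, second_smallest_eigenvalue (laplacian R e) mu &
    0 < mu /\ exists2 Y : 'cV[R]_n, Y != 0 & laplacian R e *m Y = mu *: Y.
Proof.
have [u [w [d [on pars eig cd]]]] := laplacian_frame.
pose s := sort <=%R [seq d i | i <- enum 'I_n].
have szs : size s = n by rewrite size_sort size_map size_enum_ord.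
have srt : sorted <=%R s by apply: sort_sorted; apply: le_total.
have cs : char_poly (laplacian R e) = \prod_(a <- s) ('X - a%:P).
  rewrite cd -(big_map d predT (fun a => 'X - a%:P)).
  by apply: perm_big; rewrite perm_sym perm_sort enumT.
exists s`_1; first by exists s; split.
split.
  rewrite ltNge; apply/negP => s1.
  have : (1 < count (fun x => (x <= 0)%R) s)%N.
    case: s szs srt s1 {cs} => [|s0 [|s1 s]] /=.
    - by move=> n0; move: n_gt1; rewrite -n0.
    - by move=> n0; move: n_gt1; rewrite -n0.
    by move=> _ /andP[s01 _] s1l; rewrite s1l (le_trans s01 s1l) !add1n.
  have ps : perm_eq s [seq d i | i <- enum 'I_n] by rewrite perm_sort.
  rewrite (permP ps) count_map -size_filter.
  case E : filter => [|i [|j t]] //= _.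
  have : uniq [:: i, j & t] by rewrite -E filter_uniq ?enum_uniq.
  rewrite /= inE negb_or => /andP[/andP[ij _] _].
  have nonpos k : k \in [:: i, j & t] -> d k <= 0.
    by rewrite -E mem_filter => /andP[].
  have di : d i <= 0 by apply: nonpos; rewrite inE eqxx.
  have dj : d j <= 0 by apply: nonpos; rewrite !inE eqxx orbT.
  have cst k : d k <= 0 -> (forall v, u k v = u k i) /\ (forall v, w k v = w k i).
    move=> dk; split=> v; apply: energy_eq0; rewrite /energy.
      under eq_bigr do rewrite (eig k).1 mulrCA -expr2.
      by rewrite -mulr_sumr mulr_le0_ge0 // sumr_ge0 // => ? _; apply: sqr_ge0.
    under eq_bigr do rewrite (eig k).2 mulrCA -expr2.
    by rewrite -mulr_sumr mulr_le0_ge0 // sumr_ge0 // => ? _; apply: sqr_ge0.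
  have [cui cwi] := cst _ di; have [cuj cwj] := cst _ dj.
  have dc f g a b : (forall v, f v = a) -> (forall v, g v = b) ->
      dot f g = n%:R * (a * b).
    move=> fa gb; rewrite /dot; under eq_bigr do rewrite fa gb.
    by rewrite sumr_const card_ord mulr_natl.
  have [oij1 oij2] := on i j; have [oii _] := on i i; have [ojj _] := on j j.
  move: oij1 oij2 oii ojj; rewrite (negPf ij) !eqxx.
  rewrite (dc _ _ _ _ cui cuj) (dc _ _ _ _ cwi cwj) (dc _ _ _ _ cwi cuj).
  rewrite (dc _ _ _ _ cui cwj) (dc _ _ _ _ cui cui) (dc _ _ _ _ cwi cwi).
  rewrite (dc _ _ _ _ cuj cuj) (dc _ _ _ _ cwj cwj).
  move: (u i i) (w i i) (u j i) (w j i) => a b a' b' e1 e2 e3 e4.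
  have : (n%:R * (a * a) + n%:R * (b * b)) * (n%:R * (a' * a') + n%:R * (b' * b')) = 1.
    by rewrite e3 e4 mulr1.
  have -> : (n%:R * (a * a) + n%:R * (b * b)) * (n%:R * (a' * a') + n%:R * (b' * b'))
    = (n%:R * (a * a') + n%:R * (b * b')) ^+ 2 + (n%:R * (b * a') - n%:R * (a * b')) ^+2.
    by ring.
  by rewrite e1 e2 subrr expr0n /= addr0 => /eqP; rewrite eq_sym oner_eq0.
have : root (char_poly (laplacian R e)) s`_1.
  by rewrite cs root_prod_XsubC mem_nth // szs.
rewrite -eigenvalue_root_char => /eigenvalueP[v vL vn0].
exists v^T; first by rewrite trmx_eq0.
by rewrite -{1}(laplacian_sym R se) -trmx_mul vL linearZ.
Qed.

End SecondEigenvalue.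

(** * Energy and test functions on rooted trees *)

Local Open Scope ring_scope.

Section RootedEnergy.
Variables (R : realType) (n : nat) (e : rel 'I_n) (r : 'I_n) (par : 'I_n -> 'I_n).
Variable dep : 'I_n -> nat.
Hypothesis rt : rooted e r par dep.
Local Notation anc := (anc par dep).
Implicit Types f g Y : 'I_n -> R.

Lemma rooted_edge_natr a b : (e a b)%:R =
  ((a != r) && (par a == b))%:R + ((b != r) && (par b == a))%:R :> R.
Proof.
rewrite (edgeE rt); case E : (_ && _); case F : (_ && _); rewrite ?addr0 ?add0r //.
case/andP: E => ar /eqP ab; case/andP: F => br /eqP ba.
by have := depS rt ar; have := depS rt br; rewrite ab ba; lia.
Qed.

(** Summation by parts: each edge is the parent edge of exactly one vertex. *)
Lemma rooted_energyE f g : \sum_v f v * lap e g v =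
  \sum_(v | v != r) (f v - f (par v)) * (g v - g (par v)).
Proof.
rewrite /lap.
transitivity (\sum_v \sum_u (((v != r) && (par v == u))%:R * (f v * (g v - g u))
   + ((u != r) && (par u == v))%:R * (f v * (g v - g u)))).
  apply: eq_bigr => v _; rewrite mulr_sumr; apply: eq_bigr => u _.
  by rewrite rooted_edge_natr; ring.
under eq_bigr => v _ do rewrite big_split /=.
rewrite big_split /= [X in _ + X]exchange_big /= -big_split /= [RHS]big_mkcond /=.
apply: eq_bigr => v _.
have [->|vr] /= := eqVneq v r.
  by rewrite !big1 ?addr0 // => u _; rewrite mul0r.
rewrite (bigD1 (par v)) //= eqxx mul1r big1 ?addr0.
  rewrite (bigD1 (par v)) //= eqxx mul1r big1 ?addr0; first by ring.
  by move=> u; rewrite eq_sym => /negPf ->; rewrite mul0r.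
by move=> u; rewrite eq_sym => /negPf ->; rewrite mul0r.
Qed.

Lemma energyE f : energy e f = \sum_(v | v != r) (f v - f (par v)) ^+ 2.
Proof. by rewrite /energy rooted_energyE; apply: eq_bigr => v _; rewrite expr2. Qed.

Lemma rooted_energy_ge0 f : 0 <= energy e f.
Proof. by rewrite energyE; apply: sumr_ge0 => v _; apply: sqr_ge0. Qed.

Lemma rooted_ind (P : 'I_n -> Prop) : P r ->
  (forall v, v != r -> P (par v) -> P v) -> forall v, P v.
Proof.
move=> Pr Pp v; elim: {v}(dep v) {-2}v (erefl (dep v)) => [|k IH] v dv.
  by move/eqP: dv; rewrite (dep_eq0 rt) => /eqP->.
have vr : v != r by rewrite -(dep_gt0 rt) dv.
by apply: Pp => //; apply: IH; rewrite (dep_par rt) dv.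
Qed.

Lemma rooted_energy_eq0 f : energy e f <= 0 -> forall v w, f v = f w.
Proof.
move=> h; suff cr v : f v = f r by move=> v w; rewrite !cr.
have /eqP : energy e f = 0 by apply/eqP; rewrite eq_le h rooted_energy_ge0.
rewrite energyE psumr_eq0 => [/allP h0|? _]; last exact: sqr_ge0.
elim/rooted_ind: v => // v vr <-.
have := h0 v (mem_index_enum _); rewrite vr /= sqrf_eq0 subr_eq0.
by move/eqP.
Qed.

Variable x : 'I_n.
Hypothesis xr : x != r.

Definition below v := anc x v && (v != x).

Lemma below_par v : v != r -> below (par v) -> below v.
Proof.
move=> vr /andP[a ne]; rewrite /below (anc_trans rt a (anc_par rt v)) /=.
apply: contraTneq a => ->; apply/negP => /(anc_dep rt).
by rewrite (depS rt xr) ltnn.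
Qed.

Lemma par_below v : below v -> v != r /\ (below (par v) || (par v == x)).
Proof.
move=> /andP[a ne]; have vr : v != r.
  by apply: contraTneq a => ->; rewrite (anc_of_root rt).
split=> //; move: a; rewrite (ancE rt _ vr) eq_sym (negPf ne) /= => a.
by rewrite /below a /= orbC orbN.
Qed.

Lemma below_child v : v != r -> par v = x -> below v.
Proof.
move=> vr pv; rewrite /below -pv (anc_par rt) /= eq_sym.
exact: par_neq rt _ vr.
Qed.

Section Sides.
Variables (mu : R) (Y : 'I_n -> R).
Hypothesis eigY : forall v, lap e Y v = mu * Y v.
Hypothesis below_pos : forall psi : 'I_n -> R, (forall v, 0 <= psi v) ->
  (forall v, ~~ below v -> psi v = 0) ->
  energy e psi <= mu * (\sum_v psi v ^+ 2) -> forall v, psi v = 0.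

(** Testing the eigenvalue equation against the negative part of [Y] below [x]
shows that its energy is at most [mu] times its norm, so it vanishes. *)
Lemma below_nonneg : 0 <= Y x -> forall v, below v -> 0 <= Y v.
Proof.
move=> Yx v bv; pose N v := if below v then Num.max (- Y v) 0 else 0.
have NE w : below w -> N w = Num.max (- Y w) 0 by rewrite /N => ->.
have N0 w : ~~ below w -> N w = 0 by rewrite /N => /negPf ->.
have N_ge0 w : 0 <= N w by rewrite /N; case: ifP => // _; rewrite le_max lexx orbT.
suff /(_ v) : forall w, N w = 0.
  by rewrite NE // => h; rewrite -oppr_le0 -h le_max lexx.
apply: below_pos => //.
have e1 : \sum_w N w * lap e Y w = - (mu * \sum_w N w ^+ 2).
  rewrite mulr_sumr -sumrN; apply: eq_bigr => w _; rewrite eigY.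
  have [bw|nb] := boolP (below w); last by rewrite N0 //; ring.
  rewrite NE //; have [h|h] := leP (- Y w) 0; first by ring.
  by ring.
rewrite -lerN2 -e1 rooted_energyE energyE -sumrN; apply: ler_sum => w wr.
have [bw|nb] := boolP (below w); last first.
  rewrite (N0 w) // (N0 (par w)); first by rewrite subrr mul0r expr0n oppr0.
  by apply: contra nb; apply: below_par.
have [_ bp] := par_below bw.
have Np : N (par w) = Num.max (- Y (par w)) 0.
  case/orP: bp => [/NE//|/eqP->]; rewrite N0; last by rewrite /below eqxx andbF.
  by rewrite max_r // oppr_le0.
rewrite Np (NE w) //; move: (Y w) (Y (par w)) => a b.
by have [ha|ha] := leP (- a) 0; have [hb|hb] := leP (- b) 0; nra.
Qed.

End Sides.

(** Characteristic vertices for a vector seen as a function. *)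
Definition characteristic_at Y v :=
  (Y v = 0 /\ exists2 u, e v u & Y u != 0) \/ (exists2 u, e v u & Y v * Y u < 0).

(** Without such a function the values below [x] would have the sign of
[Y x], and would vanish if [Y x] does.  The balance at [x] then makes the value
at the parent vanish as well in the second case, and in the first case only
the parent could have the opposite sign; either way [x] would not be
characteristic. *)
Lemma characteristic_test_function mu Y :
  (forall v, lap e Y v = mu * Y v) -> characteristic_at Y x -> ~ (Y (par x) * Y x < 0) ->
  exists psi : 'I_n -> R, [/\ forall v, 0 <= psi v,
    forall v, ~~ below v -> psi v = 0,
    energy e psi <= mu * (\sum_v psi v ^+ 2) & exists v, psi v != 0].
Proof.
move=> eigY cx nz; apply: contrapT => nex.
have H : forall psi : 'I_n -> R, (forall v, 0 <= psi v) ->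
    (forall v, ~~ below v -> psi v = 0) ->
    energy e psi <= mu * (\sum_v psi v ^+ 2) -> forall v, psi v = 0.
  move=> psi p0 ps pe v; apply/eqP; apply: contraT => nv.
  by exfalso; apply: nex; exists psi; split=> //; exists v.
have eigN v : lap e (fun w => - Y w) v = mu * - Y v.
  rewrite mulrN -eigY /lap -sumrN; apply: eq_bigr => u _; ring.
have pos := below_nonneg eigY H.
have neg := below_nonneg eigN H.
have nb u : e x u -> u = par x \/ below u.
  rewrite (edgeE rt) xr /= => /orP[/eqP->|/andP[ur /eqP ux]]; first by left.
  by right; apply: below_child.
have [Yx0|Yx0] := eqVneq (Y x) 0.
  have zero u : below u -> Y u = 0.
    move=> bu; apply/eqP; rewrite eq_le pos // ?Yx0 // andbT -oppr_ge0.
    by apply: neg => //; rewrite Yx0 oppr0.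
  have Yp : Y (par x) = 0.
    have := eigY x; rewrite /lap Yx0 mulr0 (bigD1 (par x)) //=.
    rewrite (edge_par rt xr) mul1r sub0r big1 ?addr0; first by move/eqP; rewrite oppr_eq0 => /eqP.
    move=> u up; have [/nb[E|/zero ->]|_] := boolP (e x u).
    - by rewrite E eqxx in up.
    - by rewrite subr0 mulr0.
    - by rewrite mul0r.
  case: cx => [[_ [u /nb[->|/zero->]]]|[u _]]; rewrite ?Yp ?eqxx //.
  by rewrite Yx0 mul0r ltxx.
case: cx => [[Y0]|[u /nb[->|bu]]]; first by rewrite Y0 eqxx in Yx0.
  by rewrite mulrC => /nz.
have [Yp|Yn] := ltP 0 (Y x).
  by have /(mulr_ge0 (ltW Yp)) := pos (ltW Yp) u bu; rewrite leNgt => /negP.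
have Yn' : 0 <= - Y x by rewrite oppr_ge0.
by have /(mulr_ge0 Yn') := neg Yn' u bu; rewrite mulrNN leNgt => /negP.
Qed.

(** The supports of [phi] and [psi] are separated by [x], so that neither the
energy nor the norm of a combination has cross terms; as both functions are
nonnegative and nonzero, some combination with nonzero coefficients has zero
sum. *)
Lemma two_sided_rayleigh mu nu rho phi psi :
  (forall f, \sum_v f v = 0 -> mu * (\sum_v f v ^+ 2) <= energy e f) ->
  (forall v, 0 <= phi v) -> (forall v, anc x v -> phi v = 0) ->
  energy e phi <= nu * (\sum_v phi v ^+ 2) -> (exists v, phi v != 0) ->
  (forall v, 0 <= psi v) -> (forall v, ~~ below v -> psi v = 0) ->
  energy e psi <= rho * (\sum_v psi v ^+ 2) -> (exists v, psi v != 0) ->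
  exists A B, [/\ 0 < A, 0 < B & mu * (A + B) <= nu * A + rho * B].
Proof.
move=> ray p0 ps pe [v0 pv0] q0 qs qe [u0 qu0].
pose a := \sum_v psi v; pose b := \sum_v phi v.
have spos (h : 'I_n -> R) w : (forall v, 0 <= h v) -> h w != 0 -> 0 < \sum_v h v.
  move=> h0 hw; rewrite (bigD1 w) //=; apply: ltr_wpDr; first exact: sumr_ge0.
  by rewrite lt_neqAle eq_sym hw h0.
have a0 : 0 < a by apply: spos qu0.
have b0 : 0 < b by apply: spos pv0.
have disj v : phi v * psi v = 0.
  have [bv|/qs->] := boolP (below v); last by rewrite mulr0.
  by case/andP: bv => /ps -> _; rewrite mul0r.
pose f v := a * phi v - b * psi v.
have f0 : \sum_v f v = 0 by rewrite sumrB -!mulr_sumr -/a -/b; ring.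
have nf : \sum_v f v ^+ 2 = a ^+ 2 * (\sum_v phi v ^+ 2) + b ^+ 2 * \sum_v psi v ^+ 2.
  rewrite !mulr_sumr -big_split; apply: eq_bigr => v _ /=.
  by have := disj v; rewrite /f => h; ring: h.
have ef : energy e f = a ^+ 2 * energy e phi + b ^+ 2 * energy e psi.
  rewrite !energyE !mulr_sumr -big_split; apply: eq_bigr => v vr /=.
  rewrite /f; have [bv|nb] := boolP (below v).
    have [_ bp] := par_below bv.
    have -> : phi v = 0 by apply: ps; case/andP: bv.
    have -> : phi (par v) = 0.
      by apply: ps; case/orP: bp => [/andP[]//|/eqP->]; apply: anc_refl.
    by ring.
  rewrite (qs v) // (qs (par v)); first by ring.
  by apply: contra nb; apply: below_par.
exists (a ^+ 2 * \sum_v phi v ^+ 2), (b ^+ 2 * \sum_v psi v ^+ 2); split.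
- apply: mulr_gt0; first exact: exprn_gt0.
  by apply: (spos _ v0) => [v|]; rewrite ?sqr_ge0 // sqrf_eq0.
- apply: mulr_gt0; first exact: exprn_gt0.
  by apply: (spos _ u0) => [v|]; rewrite ?sqr_ge0 // sqrf_eq0.
rewrite -nf; apply: le_trans (ray f f0) _; rewrite ef [nu * _]mulrCA [rho * _]mulrCA.
by apply: lerD; apply: ler_wpM2l; rewrite ?sqr_ge0.
Qed.

End RootedEnergy.

Section ChainTest.
Variables (R : realType) (n : nat) (e : rel 'I_n) (r : 'I_n) (par : 'I_n -> 'I_n).
Variable dep : 'I_n -> nat.
Hypothesis rt : rooted e r par dep.
Local Notation anc := (anc par dep).

Lemma sum_ancs w (F : nat -> R) :
  \sum_(v | (v != r) && anc v w) F (dep v) = \sum_(i < dep w) F i.+1.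
Proof.
elim/(rooted_ind rt): w => [|w wr IH].
  rewrite (dep_root rt) big_ord0 big_pred0 // => v.
  by rewrite (anc_of_root rt) andNb.
rewrite (depS rt wr) big_ord_recr /= -IH (bigD1 w) /=; last by rewrite wr anc_refl.
rewrite addrC (depS rt wr); congr (_ + _); apply: eq_bigl => v.
rewrite (ancE rt v wr); have [->|] := eqVneq v w; last by rewrite andbT.
rewrite andbF; apply/esym/negbTE; rewrite negb_and orbC; apply/orP; left.
by apply/negP => /(anc_dep rt); rewrite (depS rt wr) ltnn.
Qed.

Variable w : 'I_n.

(** The number of edges shared by the paths from the root to [v] and to [w].
A function of it follows the path to [w] and is constant on the branches
leaving that path. *)
Definition common v := #|[set y | [&& y != r, anc y v & anc y w]]|.

Lemma common_anc v : anc v w -> common v = dep v.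
Proof.
move=> a; apply/eqP; rewrite -eqSS -(card_ancs rt) (cardsD1 r) inE (anc_root rt) eqSS.
apply/eqP/eq_card => y; rewrite !inE; case: (y != r) => //=.
by apply: andb_idr => b; apply: (anc_trans rt b a).
Qed.

Lemma common_par v : v != r -> common v = (common (par v) + anc v w)%N.
Proof.
move=> vr; rewrite /common (cardsD1 v) addnC inE vr anc_refl /=; congr (_ + _)%N.
apply: eq_card => y; rewrite !inE (ancE rt y vr).
have [->|] //= := eqVneq y v; rewrite andbCA; apply/esym/andP => -[/(anc_dep rt)].
by rewrite (depS rt vr) ltnn.
Qed.

(** Only the edges of the path to [w] carry an increment. *)
Lemma chain_energy (s : nat -> R) : energy e (s \o common) =
  \sum_(i < dep w) (s i.+1 - s i) ^+ 2.
Proof.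
rewrite (energyE rt) -(sum_ancs w (fun i => (s i - s i.-1) ^+ 2)) big_mkcondr /=.
apply: eq_bigr => v vr; rewrite (common_par vr).
have [a|na] := boolP (anc v w); last by rewrite addn0 subrr expr0n.
by rewrite addn1 -(common_anc a) (common_par vr) a addn1.
Qed.

Lemma chain_norm (s : nat -> R) :
  \sum_(i < dep w) s i.+1 ^+ 2 <= \sum_v (s \o common) v ^+ 2.
Proof.
rewrite -(sum_ancs w (fun i => s i ^+ 2)) big_mkcond /=; apply: ler_sum => v _.
case: ifP => [/andP[_ a]|_]; first by rewrite (common_anc a).
exact: sqr_ge0.
Qed.

End ChainTest.

Section TwoRoots.
Variables (R : realType) (n : nat) (e : rel 'I_n).
Variables (r x : 'I_n) (par par' : 'I_n -> 'I_n) (dep dep' : 'I_n -> nat).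
Hypothesis rt : rooted e r par dep.
Hypothesis rt' : rooted e x par' dep'.
Local Notation anc' := (anc par' dep').
Local Notation anc := (anc par dep).
Local Notation below := (below par dep x).
Hypothesis xr : x != r.

Lemma below_edge a b : e a b -> a != x -> b != x -> below a = below b.
Proof.
have key c : c != r -> c != x -> par c != x -> below c = below (par c).
  move=> cr cx px; apply/idP/idP; last exact: (below_par rt xr).
  by move=> /(par_below rt xr)[_]; rewrite (negPf px) orbF.
rewrite (edgeE rt) => /orP[/andP[ar /eqP <-]|/andP[br /eqP <-]] h1 h2; first exact: key.
by rewrite -key.
Qed.

(** Rooting at [x], the branch of a vertex lies entirely below [x] for the first
root or entirely outside: such a branch can be left only through [x]. *)
Lemma below_anc y v : y != x -> anc' y v -> below y = below v.
Proof.
move=> yx; elim/(rooted_ind rt'): v => [|v vx IH].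
  by rewrite (anc_of_root rt') (negPf yx).
rewrite (ancE rt' y vx) => /orP[/eqP->//|a].
rewrite (IH a); apply/esym/below_edge => //; first exact: (edge_par rt' vx).
by apply: contraTneq a => ->; rewrite (anc_of_root rt').
Qed.

(** A test function on a path starting at [x], extended constantly to the
branches attached to the path, keeps its energy and can only gain in norm. *)
Lemma branch_test w K (s : nat -> R) (nu : R) :
  ~~ anc x w -> (0 < K <= dep' w)%N ->
  s 0%N = 0 -> (forall i, 0 <= s i) -> (exists2 i, (0 < i <= K)%N & s i != 0) ->
  \sum_(i < K) (s i.+1 - s i) ^+ 2 <= nu * (\sum_(i < K) s i.+1 ^+ 2) -> 0 <= nu ->
  exists phi : 'I_n -> R, [/\ forall v, 0 <= phi v, forall v, anc x v -> phi v = 0,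
    energy e phi <= nu * (\sum_v phi v ^+ 2) & exists v, phi v != 0].
Proof.
move=> nw /andP[K0 Kw] s0 sge [i /andP[i0 iK] si] hs nu0.
have [u au du] := anc_at rt' Kw.
have ux : u != x by rewrite -(dep_gt0 rt') du.
have nu' : ~~ below u by rewrite (below_anc ux au) /below (negPf nw).
exists (s \o common x par' dep' u); split.
- by move=> v; apply: sge.
- move=> v av /=; suff -> : common x par' dep' u v = 0%N by [].
  apply: eq_card0 => y; rewrite inE; apply/negP => /and3P[yx yv yu].
  have bv : below v.
    rewrite /below av; apply: contraTneq yv => ->.
    by rewrite (anc_of_root rt').
  by move: bv; rewrite -(below_anc yx yv) (below_anc yx yu) (negPf nu').
- rewrite (chain_energy rt') du; apply: le_trans hs _; apply: ler_wpM2l => //.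
  by have := chain_norm rt' u s; rewrite du.
- have [y ay dy] := anc_at rt' (k := i) (v := u) (ltac:(by rewrite du)).
  by exists y; rewrite /= (common_anc rt' ay) dy.
Qed.

End TwoRoots.

(** * The core center of a path-star tree *)

Local Open Scope nat_scope.

Lemma card_ord_lt n k : k <= n -> #|[set v : 'I_n | v < k]| = k.
Proof.
move=> kn; have inj : injective (widen_ord kn) by move=> a b [] /val_inj.
rewrite -[RHS]card_ord -(card_imset _ inj).
apply: eq_card => v; rewrite inE; apply/idP/imsetP => [vk|[w _ ->]]; last exact: (ltn_ord w).
by exists (Ordinal vk) => //; apply: val_inj.
Qed.

Section PathStar.
Variables (n g : nat).
Hypothesis g_gt0 : 0 < g.
Let m := n - g.
Hypothesis m_ge4 : 3 < m.

Let mn : m <= n. Proof. exact: leq_subr. Qed.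

(** The parent of [i] when the path-star tree is rooted at the path vertex [t];
the root is its own parent. *)
Definition ps_parent (t i : nat) :=
  if i < t then i.+1 else if i == t then t else if i < m then i.-1 else m.-1.
Definition ps_par t (i : 'I_n) : 'I_n := insubd i (ps_parent t i).
Definition ps_dep t (i : 'I_n) : nat :=
  if i < t then t - i else if i < m then i - t else m - t.

Lemma ps_parE t i : t < m -> ps_par t i = ps_parent t i :> nat.
Proof.
move=> tm; rewrite /ps_par insubdK // unfold_in /ps_parent; have := ltn_ord i.
by do !case: ifP => ?; lia.
Qed.

Lemma path_star_rooted t : t < m -> forall r : 'I_n, r = t :> nat ->
  rooted (path_star n g) r (ps_par t) (ps_dep t).
Proof.
move=> tm r rt; split.
- by rewrite /ps_dep rt ltnn tm subnn.
- by apply: val_inj; rewrite /= ps_parE // /ps_parent rt ltnn eqxx.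
- move=> v; rewrite -val_eqE /= rt /ps_dep ps_parE // /ps_parent.
  case: (ltngtP v t) => //= vt _; [|case: (ltnP v m) => vm];
    by do !case: ifP => ?; lia.
move=> a b; rewrite -!val_eqE /= !ps_parE // rt /path_star /path_star_arc -/m /ps_parent.
have := ltn_ord a; have := ltn_ord b.
move: (nat_of_ord a) (nat_of_ord b) => {}a {}b.
by do !case: ifP => ?; lia.
Qed.

Let n_gt0 : 0 < n. Proof. by rewrite (leq_trans _ mn) // (leq_trans _ m_ge4). Qed.
Let pt k (km : k < m) : 'I_n := Ordinal (leq_trans km mn).
Let m0 : 0 < m. Proof. by rewrite (leq_trans _ m_ge4). Qed.
Let m2 : 2 < m. Proof. by rewrite (leq_trans _ m_ge4). Qed.
Let lastm : m.-1 < m. Proof. by rewrite prednK. Qed.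
Let r0 : 'I_n := pt m0.
Let r2 : 'I_n := pt m2.
Let rt0 : rooted (path_star n g) r0 (ps_par 0) (ps_dep 0).
Proof. exact: path_star_rooted. Qed.
Let rt2 : rooted (path_star n g) r2 (ps_par 2) (ps_dep 2).
Proof. exact: path_star_rooted. Qed.
Let leaves := [set v : 'I_n | m <= v].

Lemma card_leaves : #|leaves| = g.
Proof.
have := cardsC [set v : 'I_n | v < m].
rewrite card_ord_lt // card_ord (_ : ~: _ = leaves); first by have : m = n - g by []; lia.
by apply/setP=> v; rewrite !inE -leqNgt.
Qed.

Lemma path_star_anc_end (v w : 'I_n) : v < m -> v <= w -> anc (ps_par 0) (ps_dep 0) v w.
Proof.
move=> vm vw.
have [|y ay dy] := anc_at rt0 (k := v) (v := w).
  by rewrite /ps_dep /= !subn0; case: ifP => // _; apply: ltnW.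
suff -> : v = y by [].
apply: val_inj; move: dy; rewrite /= /ps_dep /= !subn0; case: ifP => // ym E.
by rewrite -E ltnn in vm.
Qed.

Lemma path_star_upset_initial S (v w : 'I_n) :
  upset r0 (ps_par 0) S -> w \in S -> v < m -> v <= w -> v \in S.
Proof. by move=> uS wS vm vw; apply: upset_anc uS wS (path_star_anc_end vm vw). Qed.

Lemma path_star_upset_reroot S (w : 'I_n) : upset r0 (ps_par 0) S -> w \in S -> 2 <= w ->
  upset r2 (ps_par 2) S.
Proof.
move=> uS wS w2; have mem v := path_star_upset_initial (v := v) uS wS.
have /upsetP[_ pS] := uS.
apply/upsetP; split; first by apply: mem.
move=> v vS; have [v2|v2] := ltnP v 2.
  by apply: mem; rewrite ps_parE // /ps_parent v2; [apply: leq_trans m2|apply: leq_trans w2].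
have [v2'|v2'] := eqVneq (v : nat) 2.
  by apply: mem; rewrite ps_parE // /ps_parent v2' /=.
suff -> : ps_par 2 v = ps_par 0 v by apply: pS.
by apply: val_inj; rewrite /= !ps_parE // /ps_parent; do !case: ifP => ?; lia.
Qed.

(** A subtree containing the end of the path and a vertex of index at least 3
either stops before the last path vertex, at one of [m - 4] places, or contains the whole path and an arbitrary set of leaves. *)
Lemma path_star_end_count (w : 'I_n) : 3 <= w ->
  subtree_number (path_star n g) r0 w <= m - 4 + 2 ^ g.
Proof.
move=> w3; rewrite (subtree_number_root rt0).
pose L := pt lastm.
rewrite -(cardsID [set S : {set 'I_n} | L \notin S]); apply: leq_add.
  set C := _ :&: _.
  pose f := fun S : {set 'I_n} => reach (ps_par 0) (ps_dep 0) S L.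
  have dL : ps_dep 0 L = m.-1 by rewrite /ps_dep /= lastm subn0.
  have CP S : S \in C -> [/\ upset r0 (ps_par 0) S, w \in S & L \notin S].
    by rewrite !inE => /andP[/andP[-> ->] ->].
  have fS S v : S \in C -> v \in S -> v < m.
    move=> /CP[uS _ nL] vS; rewrite ltnNge; apply: contra nL => mv.
    by apply: path_star_upset_initial uS vS _ _ => //=; rewrite (leq_trans (leq_pred _) mv).
  have memf S (v : 'I_n) : S \in C -> v < m -> (v \in S) = (v <= f S).
    move=> SC vm; have [uS _ _] := CP S SC.
    rewrite (mem_reach rt0 (u := L)) //; first by rewrite /ps_dep /= vm subn0.
    by apply: path_star_anc_end => //=; rewrite -ltnS prednK.
  rewrite -(size_iota 3 (m - 4)) cardE -(size_map f).
  apply: uniq_leq_size.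
    rewrite map_inj_in_uniq ?enum_uniq // => S S'; rewrite !mem_enum => SC SC' E.
    apply/setP=> v; have [vm|vm] := ltnP v m; first by rewrite !memf // E.
    apply/idP/idP => vS; [have := fS _ _ SC vS | have := fS _ _ SC' vS];
    by rewrite ltnNge vm.
  move=> k /mapP[S]; rewrite mem_enum => SC ->; rewrite mem_iota.
  have [uS wS nL] := CP S SC.
  have wm := fS S w SC wS.
  have : f S < m.-1 by rewrite ltnNge -(memf S L).
  have : w <= f S by rewrite -memf.
  by lia.
rewrite -card_leaves -card_powerset.
set C := _ :\: _.
have CP S : S \in C -> [/\ upset r0 (ps_par 0) S, w \in S & L \in S].
  by rewrite !inE negbK => /andP[-> /andP[-> ->]].
rewrite -(card_in_imset (f := fun S => S :&: leaves) (D := C)).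
  by apply: subset_leq_card; apply/subsetP=> _ /imsetP[S _ ->]; rewrite powersetE subsetIr.
move=> S S' /CP[uS _ LS] /CP[uS' _ LS'] /setP E; apply/setP=> v.
have [vm|vm] := ltnP v m.
  have vL : v <= L by rewrite /= -ltnS prednK.
  by rewrite (path_star_upset_initial uS LS vm vL) (path_star_upset_initial uS' LS' vm vL).
by have := E v; rewrite !inE vm !andbT.
Qed.

(** The subtrees counted here consist of the path from one of the first
three vertices on, of a leaf beyond or equal to [u], and of arbitrary further
leaves. *)
Lemma path_star_third_count (u : 'I_n) : 2 <= u ->
  3 * 2 ^ g.-1 <= subtree_number (path_star n g) r2 u.
Proof.
move=> u2; rewrite (subtree_number_root rt2).
have ln : n.-1 < n by rewrite prednK.
(* a leaf whose path from the vertex of index 2 passes through u *)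
pose l : 'I_n := if m <= u then u else Ordinal ln.
have lm : l \in leaves.
  by rewrite inE /l; case: ifP => //= _; have : m = n - g by []; lia.
pose F (iK : 'I_3 * {set 'I_n}) := [set v : 'I_n | iK.1 <= v < m] :|: (l |: iK.2).
rewrite -[3]card_ord -cardsT -[g]card_leaves (cardsD1 l) lm add1n /= -card_powerset -cardsX.
rewrite -(card_in_imset (f := F)).
  apply: subset_leq_card; apply/subsetP=> S /imsetP[[i K]].
  rewrite !inE /= => Kl ->; apply/andP; split; last first.
    rewrite !inE /l; have [um|um] := leqP m u; first by rewrite eqxx orbT.
    by rewrite andbT (leq_trans _ u2) // -ltnS ltn_ord.
  have lf v : v \in l |: K -> m <= v.
    rewrite !inE => /orP[/eqP->|vK]; first by rewrite inE in lm.
    by have := subsetP Kl v vK; rewrite !inE => /andP[].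
  apply/upsetP; split; first by rewrite !inE /= m2 andbT -ltnS ltn_ord.
  move=> v; rewrite inE => vF; rewrite !inE; apply/orP; left.
  have i3 := ltn_ord i; rewrite /= ps_parE // /ps_parent.
  case/orP: vF => [|/lf mv]; last by do !case: ifP => ?; lia.
  by rewrite inE /=; do !case: ifP => ?; lia.
move=> [i K] [i' K']; rewrite !inE /= => Kl Kl' /setP E.
have ii : i = i' :> nat.
  have key (a : nat) : a < 3 -> (i <= a) = (i' <= a).
    move=> a3; have am : a < m by rewrite (leq_trans a3).
    have := E (pt am); rewrite !inE /= am !andbT.
    have nl : pt am \notin leaves by rewrite inE -ltnNge.
    have -> : (pt am == l) = false by apply: contraNF nl => /eqP->.
    have -> : (pt am \in K) = false.
      by apply: contraNF nl => /(subsetP Kl); rewrite inE => /andP[].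
    have -> : (pt am \in K') = false.
      by apply: contraNF nl => /(subsetP Kl'); rewrite inE => /andP[].
    by rewrite !orbF.
  apply/eqP; rewrite eqn_leq; have := ltn_ord i; have := ltn_ord i' => h' h.
  by rewrite (key i') // leqnn -(key i) // leqnn.
congr pair; first exact: val_inj.
apply/setP=> v; have := E v; rewrite !inE.
have [vL|vL] := boolP (v \in leaves); last first.
  move=> _; transitivity false; [|symmetry]; apply: contraNF vL.
    by move=> /(subsetP Kl); rewrite inE => /andP[].
  by move=> /(subsetP Kl'); rewrite inE => /andP[].
have -> : (v < m) = false by apply/negbTE; rewrite -leqNgt; rewrite inE in vL.
rewrite !andbF /=; have [->|] //= := eqVneq v l.
move=> _; transitivity false; [|symmetry]; apply/negbTE/negP.
  by move=> /(subsetP Kl); rewrite !inE eqxx.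
by move=> /(subsetP Kl'); rewrite !inE eqxx.
Qed.

Lemma subtree_number_sym (e : rel 'I_n) a b : subtree_number e a b = subtree_number e b a.
Proof. by apply: eq_card => G; rewrite !inE [(a \in _) && _]andbC. Qed.

(** Compare a vertex [w] of index at least 3 with the vertex of index 2.  The
former shares at most [m - 4 + 2 ^ g] subtrees with the end of the path.  The
latter shares strictly more with that end, and at least [3 * 2 ^ (g - 1)] with
the vertices on the other side. *)
Lemma path_star_core_le2 (w : 'I_n) : m - 3 <= 2 ^ (g - 1) ->
  w \in core_center (path_star n g) -> w <= 2.
Proof.
move=> hg; rewrite inE => /forallP/(_ r2); apply: contraLR; rewrite -!ltnNge => w3.
apply: leq_ltn_trans (eccentric_le _ _ r0) _; rewrite subtree_number_sym.
have [u ->] := eccentric_attained (path_star n g) r2.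
have [u2|u2] := leqP 2 u.
  apply: leq_ltn_trans (path_star_end_count w3) _.
  apply: leq_trans (path_star_third_count u2).
  have -> : 2 ^ g = 2 * 2 ^ g.-1 by rewrite -expnS prednK.
  by move: hg; rewrite subn1; move: (2 ^ _) => P; lia.
rewrite (subtree_number_root rt0) (subtree_number_root rt2).
apply: proper_card; apply/properP; split.
  apply/subsetP=> S; rewrite !inE => /andP[uS wS].
  rewrite (path_star_upset_reroot uS wS) ?(ltnW w3) //.
  by apply: path_star_upset_initial uS wS _ _; lia.
exists [set v : 'I_n | v <= 2]; rewrite !inE; last by rewrite negb_and orbC -ltnNge w3.
rewrite ltnW // andbT; apply/upsetP; split; first by rewrite inE.
move=> v; rewrite !inE ps_parE // /ps_parent => v2; by do !case: ifP => ?; lia.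
Qed.

End PathStar.

(** * Rearranging a function onto a path-star tree *)

Local Open Scope ring_scope.

Section Rearrangement.
Variables (R : realType) (n : nat) (e : rel 'I_n) (r : 'I_n) (par : 'I_n -> 'I_n).
Variable dep : 'I_n -> nat.
Hypothesis rt : rooted e r par dep.
Variable x : 'I_n.
Hypothesis xr : x != r.
Local Notation below := (below par dep x).
Variables (p D g : nat).
Let m := (n - g)%N.
Variable psi : 'I_n -> R.
Hypothesis psi_ge0 : forall v, 0 <= psi v.
Hypothesis psi_supp : forall v, ~~ below v -> psi v = 0.
Hypothesis levels : forall k, (k <= p)%N ->
  exists2 v, below v & dep v = (dep x + k.+1)%N.
Hypothesis depth : forall v, below v -> (dep v <= dep x + p.+1)%N.
Hypothesis g_gt0 : (0 < g)%N.
Hypothesis Dpm : (D + p < m)%N.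
Hypothesis m_gt3 : (3 < m)%N.
Hypothesis room : (D.+1 + #|[pred v | below v]| <= n)%N.

Let inc v : R := `|psi v - psi (par v)|.

Lemma below_dep v : below v -> (dep x < dep v)%N.
Proof.
move=> /andP[a ne]; have := anc_dep rt a; rewrite leq_eqVlt => /orP[/eqP E|//].
by rewrite (anc_eq a (anc_refl par dep v) E) eqxx in ne.
Qed.

Lemma psi_out v : v != r -> ~~ below v -> psi v - psi (par v) = 0.
Proof.
move=> vr nb; rewrite !psi_supp ?subrr //.
by apply: contra nb; apply: (below_par rt xr).
Qed.

Lemma energy_inc : energy e psi = \sum_(v | below v) inc v ^+ 2.
Proof.
rewrite (energyE rt) [LHS]big_mkcond [RHS]big_mkcond; apply: eq_bigr => v _.
have [bv|nb] := boolP (below v).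
  by have [-> _] := par_below rt xr bv; rewrite real_normK // num_real.
by case: ifP => // vr; rewrite psi_out // expr0n.
Qed.

Lemma level_choice : exists vs : nat -> 'I_n, forall k, (k < p)%N ->
  [/\ below (vs k), dep (vs k) = (dep x + k.+1)%N &
      forall v, below v -> dep v = (dep x + k.+1)%N -> inc v <= inc (vs k)].
Proof.
have ex k : exists w, (k < p)%N -> [/\ below w, dep w = (dep x + k.+1)%N &
      forall v, below v -> dep v = (dep x + k.+1)%N -> inc v <= inc w].
  have [kp|_] := ltnP k p; last by exists x.
  have [v bv dv] := levels (ltnW kp).
  pose Q := [pred v | below v && (dep v == dep x + k.+1)%N].
  have Qv : Q v by rewrite /= bv dv eqxx.
  exists [arg max_(w > v | Q w) inc w]%O => _.
  case: arg_maxP => //= w /andP[bw /eqP dw] h; split=> // u bu du.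
  by apply: h; rewrite bu du eqxx.
by have [vs vsP] := boolp.choice ex; exists vs.
Qed.

(** On each level below [x] the largest increment of [psi] goes to
the corresponding vertex of the path of the path-star tree, starting after
index [D]; the remaining increments go to vertices farther out.  The energy is
the sum of the squared increments and does not change, while each value is
bounded by a sum of increments along a path that the new function dominates. *)
Lemma path_star_rearrangement : exists psi' : 'I_n -> R, [/\ forall v, 0 <= psi' v,
  forall v : 'I_n, (v <= D)%N -> psi' v = 0,
  energy (path_star n g) psi' = energy e psi &
  \sum_v psi v ^+ 2 <= \sum_v psi' v ^+ 2].
Proof.
have [vs vsP] := level_choice.
pose Vs := [seq vs k | k <- iota 0 p].
pose rest := [seq v <- enum [pred v | below v] | v \notin Vs].
(* position i of this list is sent to the index D + 1 + i *)
pose sW := Vs ++ rest.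
have uVs : uniq Vs.
  rewrite map_inj_in_uniq ?iota_uniq // => i j; rewrite !mem_iota !add0n /=.
  move=> /vsP[_ di _] /vsP[_ dj _] E; move: di; rewrite E dj; lia.
have VsW v : v \in Vs -> below v.
  by case/mapP => k; rewrite mem_iota /= add0n => /vsP[b _ _] ->.
have memW v : (v \in sW) = below v.
  rewrite mem_cat mem_filter mem_enum inE /=.
  by have [/VsW->|_] := boolP (v \in Vs).
have uW : uniq sW.
  rewrite cat_uniq uVs filter_uniq ?enum_uniq // andbT /=.
  by apply/hasPn => v; rewrite mem_filter => /andP[].
have sumW (F : 'I_n -> R) : \sum_(v | below v) F v = \sum_(v <- sW) F v.
  transitivity (\sum_(v <- enum [pred v | below v]) F v); first by rewrite big_enum.
  apply/perm_big/uniq_perm; rewrite ?enum_uniq // => v.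
  by rewrite memW mem_enum.
have szW : size sW = #|[pred v | below v]|.
  by rewrite cardE; apply/perm_size/uniq_perm; rewrite ?enum_uniq // => v; rewrite memW mem_enum.
pose a j := (map inc sW)`_j.
have a_ge0 j : 0 <= a j.
  rewrite /a; have [js|js] := ltnP j (size sW).
    by rewrite (nth_map x) // normr_ge0.
  by rewrite nth_default // size_map.
have aE i : (i < size sW)%N -> a i = inc (nth x sW i).
  by move=> h; rewrite /a (nth_map x).
have nthV i : (i < p)%N -> nth x sW i = vs i.
  by move=> ip; rewrite nth_cat size_map size_iota ip (nth_map 0%N) ?size_iota // nth_iota.
have pW : (p <= size sW)%N by rewrite size_cat size_map size_iota leq_addr.
pose S k := \sum_(i < k) a i.
have S_mono i j : (i <= j)%N -> S i <= S j.
  move=> /subnKC <-; rewrite /S big_split_ord /= lerDl.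
  by apply: sumr_ge0.
(* one increment per level, each at most the largest one on its level *)
have level_bound k : (k <= p)%N -> forall v, below v -> dep v = (dep x + k.+1)%N ->
    psi v <= S k + inc v.
  elim: k => [|k IH] kp v bv dv.
    have [vr bp] := par_below rt xr bv.
    have -> : S 0%N = 0 by rewrite /S big_ord0.
    have pp : psi (par v) = 0.
      apply: psi_supp; apply/negP => /below_dep; rewrite (dep_par rt) dv; lia.
    by rewrite add0r /inc pp subr0 ler_norm.
  have [vr bp] := par_below rt xr bv.
  have dp : dep (par v) = (dep x + k.+1)%N by rewrite (dep_par rt) dv; lia.
  have {}bp : below (par v).
    by case/orP: bp => // /eqP E; move: dp; rewrite E; lia.
  have h1 := IH (ltnW kp) _ bp dp.
  have [_ _ h2] := vsP k kp; have {}h2 := h2 _ bp dp.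
  have ak : a k = inc (vs k) by rewrite aE ?nthV // (leq_trans kp).
  rewrite /S big_ord_recr /= -/(S k) ak.
  have : psi v - psi (par v) <= inc v by apply: ler_norm.
  move: h1 h2; lra.
pose g' j := if (D < j)%N then a (j - D.+1)%N else 0.
have g'_ge0 j : 0 <= g' j by rewrite /g'; case: ifP.
have sumg' t M : (D.+1 + t <= M)%N -> S t <= \sum_(k < M) g' k.
  move=> tM; rewrite -(subnKC tM) big_split_ord /= big_split_ord /= -addrA.
  rewrite [X in _ <= X + _]big1 ?add0r; last first.
    by move=> i _; rewrite /g' ltnNge -ltnS ltn_ord.
  rewrite (eq_bigr (fun i : 'I_t => a i)) ?lerDl ?sumr_ge0 //.
  by move=> i _; rewrite /g' /= ltn_addr // addKn.
(* the sum of the increments on the path from index 0 to j: a pendant vertex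
   j >= m comes right after the whole path *)
pose psi' (j : 'I_n) := \sum_(k < minn j m) g' k + g' j.
have psi'_ge0 j : 0 <= psi' j by rewrite addr_ge0 // sumr_ge0.
have Dm : (D < m)%N by apply: leq_ltn_trans Dpm; rewrite leq_addr.
exists psi'; split=> //.
- move=> v vD; rewrite /psi' /g' ltnNge vD /= addr0 big1 // => k _.
  rewrite ltnNge (leq_trans _ vD) //.
  by apply: ltnW; apply: leq_trans (ltn_ord k) (geq_minl _ _).
- have n0 : (0 < n)%N by have := leq_subr g n; rewrite -/m; lia.
  have m0 : (0 < m)%N by lia.
  have rt0 := path_star_rooted g_gt0 m_gt3 m0 (erefl : Ordinal n0 = 0%N :> nat).
  rewrite (energyE rt0) energy_inc sumW.
  transitivity (\sum_(j < n) g' j ^+ 2).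
    rewrite [RHS](bigD1 (Ordinal n0)) //= [g' 0%N]/g' /= expr0n add0r.
    apply: eq_bigr => j j0; have {}j0 : (0 < j)%N by rewrite lt0n.
    congr (_ ^+ 2); rewrite /psi' (ps_parE g_gt0 m_gt3) // /ps_parent /= -/m.
    rewrite gtn_eqF //.
    have [jm|jm] := ltnP j m.
      rewrite (@minn_idPl j.-1 m _); last by lia.
      by rewrite -[in X in X - _](prednK j0) big_ord_recr /= (prednK j0); ring.
    rewrite (@minn_idPl m.-1 m _); last by lia.
    by rewrite -[in X in X - _](prednK m0) big_ord_recr /=; ring.
  rewrite -(big_map inc predT (fun t => t ^+ 2)) (big_nth 0) size_map big_mkord.
  have shift t N : (D.+1 + t <= N)%N -> (forall i, (t <= i)%N -> a i = 0) ->
      \sum_(j < N) g' j ^+ 2 = \sum_(i < t) a i ^+ 2.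
    move=> tN a0; rewrite -(subnKC tN) big_split_ord /= big_split_ord /= big1 ?add0r; last first.
      by move=> i _; rewrite /g' ltnNge -ltnS ltn_ord expr0n.
    rewrite [X in _ + X]big1 ?addr0.
      by apply: eq_bigr => i _; rewrite /g' /= ltn_addr // addKn.
    move=> i _; rewrite /g' /= -addnA ltn_addr // addKn a0 ?expr0n //.
    exact: leq_addr.
  apply: shift; first by rewrite szW.
  by move=> i ti; rewrite /a nth_default // size_map.
have -> : \sum_v psi v ^+ 2 = \sum_(v | below v) psi v ^+ 2.
  rewrite [RHS]big_mkcond; apply: eq_bigr => v _; case: ifPn => // /psi_supp ->.
  by rewrite expr0n.
rewrite sumW (big_nth x) big_mkord.
have point (i : 'I_(size sW)) (j : 'I_n) : j = (D.+1 + i)%N :> nat ->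
    psi (nth x sW i) <= psi' j.
  move=> ji; have bi : below (nth x sW i) by rewrite -memW mem_nth.
  have gj : g' j = inc (nth x sW i) by rewrite /g' ji ltn_addr // addKn aE.
  rewrite /psi' gj; have [ip|ip] := ltnP i p.
    have [bv dv _] := vsP i ip; rewrite nthV //.
    apply: le_trans (level_bound i (ltnW ip) _ bv dv) _; rewrite lerD2r.
    by apply: sumg'; rewrite ji leq_min leqnn /=; lia.
  have dl := below_dep bi; have dh := depth bi.
  pose k := (dep (nth x sW i) - (dep x).+1)%N.
  have dk : dep (nth x sW i) = (dep x + k.+1)%N by rewrite /k; lia.
  have kp : (k <= p)%N by rewrite /k; lia.
  apply: le_trans (level_bound k kp _ bi dk) _; rewrite lerD2r.
  apply: le_trans (S_mono k p kp) _.
  by apply: sumg'; rewrite ji leq_min; lia.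
apply: (@le_trans _ _ (\sum_(i < size sW) (\sum_(j : 'I_n | j == (D.+1 + i)%N :> nat) psi' j ^+ 2))).
  apply: ler_sum => i _.
  have jn : (D.+1 + i < n)%N by apply: leq_trans room; rewrite -szW ltn_add2l.
  rewrite (bigD1 (Ordinal jn)) //=; apply: ler_wpDr.
    by apply: sumr_ge0 => ? _; apply: sqr_ge0.
  rewrite ler_sqr ?nnegrE ?psi_ge0 //; exact: point.
rewrite (exchange_big_dep predT) //=; apply: ler_sum => j _.
have [jD|jD] := ltnP D j; last first.
  by rewrite big_pred0 ?sqr_ge0 // => i; apply/negbTE; rewrite neq_ltn; apply/orP; left; lia.
have [js|js] := ltnP (j - D.+1)%N (size sW).
  rewrite (big_pred1 (Ordinal js)) // => i.
  apply/eqP/eqP => [ji|->] /=; last by lia.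
  by apply: val_inj => /=; lia.
by rewrite big_pred0 ?sqr_ge0 // => i; apply/negbTE; have := ltn_ord i; lia.
Qed.

End Rearrangement.

(** * Dirichlet eigenvectors of paths and Fiedler vectors of path-stars *)

Local Open Scope ring_scope.

Section Comparison.
Variable R : realType.
Implicit Types (y phi : nat -> R) (mu nu : R) (K : nat).

(** The eigenvalue equation at the first [K] vertices of a path that starts
with a pendant vertex; [K] is the index of the first vertex where it need not
hold. *)
Definition path_eigen mu y K := y 1%N = (1 - mu) * y 0%N /\
  forall j, (j.+2 <= K)%N -> y j.+2 = (2 - mu) * y j.+1 - y j.

(** The eigenvector is [cos ((2 j + 1) a)] with [a = pi / (2 (2 K + 1))], for
the eigenvalue [2 - 2 cos (2 a)]. *)
Lemma dirichlet_path K : (0 < K)%N -> exists nu phi,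
  [/\ 0 <= nu, path_eigen nu phi K, forall j, (j < K)%N -> 0 < phi j & phi K = 0].
Proof.
move=> K0; have N0 : (K.*2.+1)%:R != 0 :> R by rewrite pnatr_eq0.
have [N NE] : exists N, (K.*2.+1)%:R = N :> R by exists (K.*2.+1)%:R.
pose a : R := trigo.pi / (K.*2.+1)%:R / 2.
have a0 : 0 < a by rewrite !divr_gt0 // ?trigo.pi_gt0 ?ltr0n.
pose phi j : R := trigo.cos ((j.*2.+1)%:R * a).
have rec x : trigo.cos (x + 2 * a) = 2 * trigo.cos (2 * a) * trigo.cos x - trigo.cos (x - 2 * a).
  by rewrite trigo.cosB trigo.cosD; ring.
exists (2 - 2 * trigo.cos (2 * a)), phi; split.
- by have := trigo.cos_le1 (2 * a); lra.
- split=> [|j _]; rewrite /phi.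
    have -> : (1.*2.+1)%:R * a = a + 2 * a.
      by rewrite doubleS -!natr1; ring.
    rewrite rec (_ : a - 2 * a = - a); last by ring.
    by rewrite trigo.cosN mul1r; ring.
  have -> : (j.+2.*2.+1)%:R * a = (j.+1.*2.+1)%:R * a + 2 * a.
    by rewrite !doubleS -!natr1; ring.
  rewrite rec; have -> : (j.+1.*2.+1)%:R * a - 2 * a = (j.*2.+1)%:R * a.
    by rewrite !doubleS -!natr1; ring.
  by ring.
- move=> j jK; apply: trigo.cos_gt0_pihalf.
  have pi0 := trigo.pi_gt0 R.
  have aE : trigo.pi / 2 = (K.*2.+1)%:R * a :> R.
    by rewrite /a NE; field; rewrite -NE.
  rewrite aE ltr_pM2r // ltr_nat ltnS ltn_double jK andbT.
  apply: (@lt_trans _ _ 0); last by rewrite mulr_gt0 // ltr0n.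
  by rewrite oppr_lt0 mulr_gt0 // ltr0n.
- rewrite /phi (_ : _ * a = trigo.pi / 2) ?trigo.cos_pihalf //.
  by rewrite /a NE; field; rewrite -NE.
Qed.

Lemma path_eigen_energy nu phi K : (0 < K)%N -> path_eigen nu phi K -> phi K = 0 ->
  \sum_(j < K) (phi j.+1 - phi j) ^+ 2 = nu * \sum_(j < K) phi j ^+ 2.
Proof.
case: K => // K _ [p1 pS] pK.
suff part k : (k <= K)%N -> \sum_(j < k.+1) (phi j.+1 - phi j) ^+ 2 =
    nu * (\sum_(j < k.+1) phi j ^+ 2) + phi k.+1 * (phi k.+1 - phi k).
  by rewrite part // pK mul0r addr0.
elim: k => [|k IH] kK.
  by rewrite !big_ord1 p1; ring.
rewrite big_ord_recr /= IH ?(ltnW kK) // [in RHS]big_ord_recr /= pS //.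
ring.
Qed.

(** The discrete Wronskian [phi j * y (j + 1) - phi (j + 1) * y j] starts
nonnegative and grows by [(nu - mu) * phi j * y j]; as long as it is nonnegative
[y] stays positive wherever [phi] does. *)
Lemma sturm_comparison mu nu y phi K : (0 < K)%N -> mu <= nu ->
  path_eigen mu y K -> path_eigen nu phi K ->
  (forall j, (j < K)%N -> 0 < phi j) -> phi K = 0 -> 0 < y 0%N ->
  (forall j, (j < K)%N -> 0 < y j) /\ 0 <= y K.
Proof.
case: K => // K _ munu [y1 yS] [p1 pS] pos pK y0.
have wr j : (j <= K)%N -> 0 < y j /\ 0 <= phi j * y j.+1 - phi j.+1 * y j.
  elim: j => [|j IH] jK.
    split=> //; rewrite y1 p1.
    rewrite (_ : _ - _ = (nu - mu) * (phi 0%N * y 0%N)); last by ring.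
    by rewrite mulr_ge0 ?subr_ge0 // mulr_ge0 // ltW // pos.
  have [yj wj] := IH (ltnW jK).
  have pj : 0 < phi j by apply: pos; rewrite ltnW.
  have pj1 : 0 < phi j.+1 by apply: pos.
  have yj1 : 0 < y j.+1.
    rewrite -(pmulr_rgt0 _ pj); have : 0 < phi j.+1 * y j by rewrite mulr_gt0.
    by move: wj; lra.
  split=> //; rewrite yS // pS //.
  rewrite (_ : _ - _ = (nu - mu) * (phi j.+1 * y j.+1)
                      + (phi j * y j.+1 - phi j.+1 * y j)); last by ring.
  by rewrite addr_ge0 // mulr_ge0 ?subr_ge0 // mulr_ge0 // ltW.
split=> [j jK|]; first by case: (wr j).
have [yK] := wr K (leqnn K); rewrite pK mul0r subr0.
by rewrite pmulr_rge0 // pos.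
Qed.

Lemma path_eigen0 mu y K : path_eigen mu y K -> y 0%N = 0 ->
  forall j, (j <= K)%N -> y j = 0.
Proof.
move=> [y1 yS] y0 j jK.
suff h i : (i.+1 <= K)%N -> y i = 0 /\ y i.+1 = 0.
  by case: j jK => // j /h[].
elim: i => [|i IH] iK; first by rewrite y1 y0 mulr0.
by have [h0 h1] := IH (ltnW iK); rewrite yS // h0 h1 mulr0 subr0.
Qed.

Section PathStarFiedler.
Variables (n g K : nat).
Let m := (n - g)%N.
Hypothesis Km : (K < m)%N.
Hypothesis K0 : (0 < K)%N.

Let mn : (m <= n)%N. Proof. exact: leq_subr. Qed.
Variables (mu nu : R) (Y : 'I_n -> R) (phi : nat -> R).
Hypothesis eigY : forall v, lap (path_star n g) Y v = mu * Y v.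
Hypothesis munu : mu <= nu.
Hypothesis eigphi : path_eigen nu phi K.
Hypothesis phi_pos : forall j, (j < K)%N -> 0 < phi j.
Hypothesis phiK : phi K = 0.

Let y j := if insub j is Some v then Y v else 0.

Let yE (v : 'I_n) : y v = Y v.
Proof. by rewrite /y valK. Qed.

Lemma path_star_nbr (v u : 'I_n) : (v < m.-1)%N ->
  path_star n g v u = (u == v.+1 :> nat) || (v == u.+1 :> nat).
Proof.
rewrite /path_star /path_star_arc -/m; move: (nat_of_ord v) (nat_of_ord u); lia.
Qed.

Lemma path_star_path_eigen : path_eigen mu y K.
Proof.
have lt j : (j <= K)%N -> (j < n)%N by move=> h; lia.
split=> [|j jK].
  have l0 := lt 0%N isT; have l1 := lt 1%N K0.
  have := eigY (Ordinal l0); rewrite /lap (bigD1 (Ordinal l1)) //= path_star_nbr /=; last by lia.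
  rewrite mul1r big1 ?addr0 => [|u].
    rewrite -(yE (Ordinal l0)) -(yE (Ordinal l1)) /=; lra.
  rewrite -val_eqE /= => u1; rewrite path_star_nbr /=; last by lia.
  by rewrite (negPf u1) mul0r.
have l0 := lt j (ltnW (ltnW jK)); have l1 := lt j.+1 (ltnW jK); have l2 := lt j.+2 jK.
have := eigY (Ordinal l1); rewrite /lap (bigD1 (Ordinal l0)) //= path_star_nbr /=; last by lia.
rewrite eqxx orbT mul1r (bigD1 (Ordinal l2)) /=; last by rewrite -val_eqE /=; lia.
rewrite path_star_nbr /=; last by lia.
rewrite eqxx mul1r big1 ?addr0 => [|u /andP[]].
  rewrite -(yE (Ordinal l0)) -(yE (Ordinal l1)) -(yE (Ordinal l2)) /=; lra.
rewrite -!val_eqE /= => u0 u2; rewrite path_star_nbr /=; last by lia.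
rewrite (negPf u2) eqSS eq_sym (negPf u0) mul0r //.
Qed.

(** If [Y] does not vanish at the end of the path, it keeps its sign up to
index [K]; if it does, it vanishes up to index [K]. *)
Lemma path_star_char_far v : characteristic_at (path_star n g) Y v -> (K <= v)%N.
Proof.
move=> cv; rewrite leqNgt; apply/negP => vK.
have pe := path_star_path_eigen.
have nb u : path_star n g v u -> (u <= K)%N.
  by rewrite path_star_nbr; lia.
have sgn z : path_eigen mu z K -> 0 < z 0%N -> 0 < z v /\ forall u : 'I_n,
    path_star n g v u -> 0 <= z u.
  move=> pz z0; have [zp zK] := sturm_comparison K0 munu pz eigphi phi_pos phiK z0.
  split; first exact: zp.
  by move=> u /nb; rewrite leq_eqVlt => /orP[/eqP->//|/zp/ltW].
have pn : path_eigen mu (fun j => - y j) K.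
  by case: pe => p1 pS; split=> [|j jK]; rewrite ?p1 ?pS //; ring.
case: (ltgtP 0 (y 0%N)) => y0.
- have [vp up] := sgn y pe y0.
  case: cv => [[v0 _]|[u /up uv]]; first by rewrite yE v0 ltxx in vp.
  by rewrite ltNge mulr_ge0 // -?yE // ltW.
- have [|vp up] := sgn _ pn; first by rewrite oppr_gt0.
  case: cv => [[v0 _]|[u /up uv]]; first by rewrite yE v0 oppr0 ltxx in vp.
  by rewrite -mulrNN ltNge -!yE mulr_ge0 // ltW.
have z := path_eigen0 pe (esym y0).
case: cv => [[_ [u /nb/z]]|[u _]]; first by rewrite yE => ->; rewrite eqxx.
by rewrite -[Y v]yE z ?mul0r ?ltxx // ltnW.
Qed.

End PathStarFiedler.
End Comparison.

(** The Dirichlet eigenvector read from its zero, as a function of the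
distance to the vertex [x] of the branch test. *)
Lemma dirichlet_path_energy (R : realType) (nu : R) phi K : (0 < K)%N ->
  path_eigen nu phi K -> phi K = 0 -> let s i := phi (K - i)%N in
  \sum_(i < K) (s i.+1 - s i) ^+ 2 = nu * \sum_(i < K) s i.+1 ^+ 2.
Proof.
move=> K0 pe pK s; rewrite (reindex_inj rev_ord_inj) /=.
have -> : \sum_(i < K) s i.+1 ^+ 2 = \sum_(i < K) phi i ^+ 2.
  rewrite (reindex_inj rev_ord_inj) /=; apply: eq_bigr => i _.
  by rewrite /s subnSK // subKn // ltnW.
rewrite -(path_eigen_energy K0 pe pK); apply: eq_bigr => i _.
by rewrite /s subnSK // !subKn // ?(ltnW (ltn_ord i)) // -sqrrN opprB.
Qed.

Lemma path_branch_test (R : realType) n (e : rel 'I_n) r x par par' dep dep'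
    w K (nu : R) phi :
  rooted e r par dep -> rooted e x par' dep' -> x != r ->
  ~~ anc par dep x w -> (0 < K <= dep' w)%N -> 0 <= nu -> path_eigen nu phi K ->
  (forall j, (j < K)%N -> 0 < phi j) -> phi K = 0 ->
  exists f : 'I_n -> R, [/\ forall v, 0 <= f v, forall v, anc par dep x v -> f v = 0,
    energy e f <= nu * (\sum_v f v ^+ 2) & exists v, f v != 0].
Proof.
move=> rt rt' xr nw Kw nu0 pe phi_pos phiK; have /andP[K0 _] := Kw.
apply: (branch_test rt rt' xr (K := K) (s := fun i => phi (K - i)%N) nw Kw) => //.
- by rewrite subn0.
- move=> i; case: i => [|i]; first by rewrite subn0 phiK.
  by apply: ltW; apply: phi_pos; lia.
- by exists K; rewrite ?K0 ?leqnn // subnn gt_eqF // phi_pos.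
- by rewrite (dirichlet_path_energy K0 pe phiK).
Qed.

Lemma path_star_second_eigenvalue_le (R : realType) n g K (nu : R) phi (psi : 'I_n -> R) mu :
  (0 < g)%N -> (3 < n - g)%N -> (0 < K < n - g)%N ->
  0 <= nu -> path_eigen nu phi K -> (forall j, (j < K)%N -> 0 < phi j) -> phi K = 0 ->
  (forall v, 0 <= psi v) -> (forall v : 'I_n, (v <= K)%N -> psi v = 0) ->
  (exists v, psi v != 0) ->
  energy (path_star n g) psi <= nu * \sum_v psi v ^+ 2 ->
  second_smallest_eigenvalue (laplacian R (path_star n g)) mu -> mu <= nu.
Proof.
move=> g0 m3 /andP[K0 Km] nu0 pe phi_pos phiK psi_ge0 psi_supp psi_n0 psi_e smu.
have Kn : (K < n)%N by lia.
have n0 : (0 < n)%N by lia.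
have n1 : (1 < n)%N by lia.
have m0 : (0 < n - g)%N by lia.
pose r0 := Ordinal n0; pose x := Ordinal Kn.
have rt := path_star_rooted g0 m3 m0 (erefl : r0 = 0%N :> nat).
have rt' := path_star_rooted g0 m3 Km (erefl : x = K :> nat).
have xr : x != r0 by rewrite -val_eqE /= -lt0n.
have [||f [f0 fs fe fn]] := path_branch_test (w := r0) (K := K) rt rt' xr _ _ nu0 pe phi_pos phiK.
- by rewrite (anc_of_root rt).
- by rewrite K0 /ps_dep /= K0 subn0.
have ray := second_eigenvalue_rayleigh n1 (edge_sym rt) (rooted_energy_ge0 rt)
  (rooted_energy_eq0 (R := R) rt) smu.
have supp v : ~~ below (ps_par g 0) (ps_dep g 0) x v -> psi v = 0.
  move=> nb; apply: psi_supp; rewrite leqNgt; apply: contra nb => Kv.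
  rewrite /below (path_star_anc_end g0 m3) //=; last exact: ltnW.
  by rewrite -val_eqE /= gtn_eqF.
have [A [B [A0 B0]]] := two_sided_rayleigh rt xr ray f0 fs fe fn psi_ge0 supp psi_e psi_n0.
by rewrite -mulrDr ler_pM2r // addr_gt0.
Qed.

(** The functions [f] on the path side and [psi] below [x] have quotients [nu]
and [mu]; the part of [psi] cancels in the two-sided inequality. *)
Lemma second_eigenvalue_le_path (R : realType) n (e : rel 'I_n) r x par par' dep dep' K
    (nu mu : R) phi psi w :
  (1 < n)%N ->
  rooted e r par dep -> rooted e x par' dep' -> x != r ->
  ~~ anc par dep x w -> (0 < K <= dep' w)%N -> 0 <= nu -> path_eigen nu phi K ->
  (forall j, (j < K)%N -> 0 < phi j) -> phi K = 0 ->
  second_smallest_eigenvalue (laplacian R e) mu ->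
  (forall v, 0 <= psi v) -> (forall v, ~~ below par dep x v -> psi v = 0) ->
  energy e psi <= mu * (\sum_v psi v ^+ 2) -> (exists v, psi v != 0) ->
  mu <= nu.
Proof.
move=> n1 rt rt' xr nw Kw nu0 pe phi_pos phiK smu q0 qs qe qn.
have [f [f0 fs fe fn]] := path_branch_test rt rt' xr nw Kw nu0 pe phi_pos phiK.
have ray := second_eigenvalue_rayleigh n1 (edge_sym rt) (rooted_energy_ge0 rt)
  (rooted_energy_eq0 (R := R) rt) smu.
have [A [B [A0 B0]]] := two_sided_rayleigh rt xr ray f0 fs fe fn q0 qs qe qn.
by rewrite mulrDr lerD2r ler_pM2r.
Qed.

(** * Distances between the centers *)

Local Open Scope nat_scope.

Section Distances.
Variables (n : nat) (e : rel 'I_n).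

Lemma dist_path u v p : path e u p -> last u p = v -> dist e u v <= size p.
Proof.
move=> pp lv.
have [q [qq lq uq sq]] : exists q, [/\ path e u q, last u q = v, uniq (u :: q) & size q <= size p].
  case: (shortenP pp) lv => q qq uq sub lq; exists q; split=> //.
  by apply: uniq_leq_size sub; case/andP: uq.
apply: leq_trans sq; rewrite leqNgt; apply/negP => lt.
have qn : size q < n.
  by have := card_uniqP uq => /= <-; rewrite -[X in _ <= X]card_ord max_card.
have := before_find 0 lt; rewrite nth_iota // add0n => /existsP[].
by exists (in_tuple q); rewrite /simple_path qq lq eqxx.
Qed.

Lemma dist_ge d u v : d <= n ->
  (forall p, path e u p -> last u p = v -> d <= size p) -> d <= dist e u v.
Proof.
move=> dn h; rewrite leqNgt; apply/negP => lt.
have fn : dist e u v < n by apply: leq_trans lt dn.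
have hs : has (fun k => [exists p : k.-tuple 'I_n, simple_path e u v p]) (iota 0 n).
  by rewrite has_find size_iota.
have := nth_find 0 hs; rewrite -/(dist e u v) nth_iota // add0n.
move=> /existsP[p /and3P[pp /eqP lp _]].
by have := h p pp lp; rewrite size_tuple leqNgt lt.
Qed.

Lemma bigmin_le (A : {set 'I_n}) (F : 'I_n -> nat) x :
  x \in A -> \big[minn/n]_(y in A) F y <= F x.
Proof.
move=> xA; have : x \in index_enum 'I_n by rewrite mem_index_enum.
elim: (index_enum _) => // a s IH; rewrite big_cons inE => /orP[/eqP<-|/IH h].
  by rewrite xA geq_minl.
by case: ifP => // _; rewrite (leq_trans (geq_minr _ _)).
Qed.

Lemma set_dist_le (X Y : {set 'I_n}) x y : x \in X -> y \in Y ->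
  set_dist e X Y <= dist e x y.
Proof.
move=> xX yY; apply: leq_trans (bigmin_le _ xX) _; exact: bigmin_le.
Qed.

Lemma set_dist_ge d (X Y : {set 'I_n}) : d <= n ->
  (forall x y, x \in X -> y \in Y -> d <= dist e x y) -> d <= set_dist e X Y.
Proof.
move=> dn h; rewrite /set_dist.
elim/big_ind: _ => // [a b da db|x xX]; first by rewrite leq_min da.
elim/big_ind: _ => // [a b da db|y yY]; first by rewrite leq_min da.
exact: h.
Qed.

End Distances.

(** The index, cut off at the length of the path, changes by at most one along
an edge. *)
Lemma path_star_dist n g (v w : 'I_n) d : 0 < n - g -> d <= n ->
  w + d <= v -> w + d < n - g -> d <= dist (path_star n g) v w.
Proof.
move=> m0 dn wv wm; apply: dist_ge => // p.
suff h : minn v (n - g) <= minn (last v p) (n - g) + size p -> last v p = w -> d <= size p.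
  move=> pp; apply: h; elim: p v pp {wv} => [|a p IH] v //=; first by rewrite addn0.
  move=> /andP[va pa]; have {IH} := IH a pa.
  move: va; rewrite /path_star /path_star_arc; move: (nat_of_ord v) (nat_of_ord a).
  by move: (nat_of_ord (last a p)) => l i j; lia.
by move=> h lw; move: h; rewrite lw; lia.
Qed.

Section RootedDistances.
Variables (n : nat) (e : rel 'I_n) (r : 'I_n) (par : 'I_n -> 'I_n).
Variable dep : 'I_n -> nat.
Hypothesis rt : rooted e r par dep.

Lemma dep_lt v : dep v < n.
Proof. by rewrite -(card_ancs rt v) -[X in _ <= X]card_ord max_card. Qed.

Lemma dist_iter_par k v : k <= dep v -> dist e v (iter k par v) <= k.
Proof.
move=> kv; have [p [pp lp sp]] : exists p, [/\ path e v p, last v p = iter k par v & size p = k].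
  elim: k kv => [|k IH] kv; first by exists [::].
  have [p [pp lp sp]] := IH (ltnW kv).
  exists (rcons p (iter k.+1 par v)); rewrite rcons_path last_rcons size_rcons pp lp sp.
  split=> //=; rewrite (edge_par rt) // -(dep_gt0 rt) (dep_iter rt) subn_gt0 //.
by rewrite -[X in _ <= X]sp; apply: dist_path.
Qed.

Lemma lipschitz_path (h : 'I_n -> nat) a p :
  (forall v, v != r -> h v <= (h (par v)).+1 /\ h (par v) <= (h v).+1) ->
  path e a p -> h a <= h (last a p) + size p.
Proof.
move=> lip; elim: p a => [|b p IH] a /=; first by rewrite addn0.
case/andP=> ab /IH h1; rewrite addnS.
move: ab; rewrite (edgeE rt) => /orP[/andP[/lip[h2 _] /eqP E]|/andP[/lip[_ h2] /eqP E]];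
  rewrite E in h2; lia.
Qed.

Lemma dist_root v : dist e v r = dep v.
Proof.
apply/eqP; rewrite eqn_leq; apply/andP; split.
  by rewrite -{1}(iter_dep rt v); apply: dist_iter_par.
apply: dist_ge => [|p pp lp]; first exact: ltnW (dep_lt v).
have := lipschitz_path (h := dep) _ pp; rewrite lp (dep_root rt); apply.
by move=> u ur; rewrite (depS rt ur); split; lia.
Qed.

Variables (par' : 'I_n -> 'I_n) (dep' : 'I_n -> nat) (x : 'I_n).
Hypothesis rt' : rooted e x par' dep'.

Lemma path_to_other_root v : exists p, [/\ path e v p, last v p = x & size p = dep' v].
Proof.
elim/(rooted_ind rt'): v => [|v vx [p [pp lp sp]]].
  by exists [::]; rewrite (dep_root rt').
by exists (par' v :: p); rewrite /= (edge_par rt' vx) pp lp sp (depS rt' vx).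
Qed.

(** The path from [w] to [x] climbs to the root [r] and descends again; signed
depth, shifted by [n] to stay in the natural numbers, detects this. *)
Lemma dep_other_root c w : c != r -> par c = r -> anc par dep c x -> ~~ anc par dep c w ->
  dep w + dep x <= dep' w.
Proof.
move=> cr pc cx cw; have [p [pp lp <-]] := path_to_other_root w.
pose h v := if anc par dep c v then n - dep v else n + dep v.
have := lipschitz_path (h := h) _ pp; rewrite lp /h cx (negPf cw) => key.
have xn := dep_lt x.
suff : n + dep w <= n - dep x + size p by lia.
apply: key => v vr; rewrite (ancE rt c vr); have dv := depS rt vr; have vn := dep_lt v.
have [E|ne] /= := eqVneq c v; last by case: ifP; lia.
have -> : anc par dep c (par v) = false.
  by rewrite -E pc (anc_of_root rt) (negPf cr).
by move: dv; rewrite -E pc (dep_root rt); lia.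
Qed.

End RootedDistances.

(** A Fiedler vector without characteristic vertex is zero
everywhere or of one strict sign, but its eigenvalue is positive and so its sum
is zero. *)
Lemma characteristic_center_exists (R : realType) n (e : rel 'I_n) r par dep :
  rooted e r par dep -> 1 < n -> exists v, v \in characteristic_center R e.
Proof.
move=> rt n1.
have [mu smu [mu0 [Y Yn0 LY]]] := second_smallest_exists n1 (edge_sym rt)
  (rooted_energy_eq0 (R := R) rt).
have eigY v : lap e (fun w => Y w ord0) v = (mu * Y v ord0)%R.
  by rewrite -laplacian_mulE LY mxE.
have fY : fiedler_vector e Y by exists mu.
suff [v cv] : exists v, characteristic_vertex e Y v.
  by exists v; rewrite inE; apply/asboolP; exists Y.
apply: contrapT => nex.
have sumY : (\sum_v Y v ord0 = 0)%R.
  have : (mu * \sum_v Y v ord0 = 0)%R.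
    transitivity (\sum_v 1 * lap e (fun w => Y w ord0) v)%R.
      by rewrite mulr_sumr; apply: eq_bigr => v _; rewrite mul1r eigY.
    by rewrite (rooted_energyE rt) big1 // => v _; rewrite subrr mul0r.
  by move/eqP; rewrite mulf_eq0 gt_eqF //= => /eqP.
have nz u v : e u v -> Y u ord0 = 0%R -> Y v ord0 = 0%R.
  move=> uv u0; apply/eqP; apply: contraT => vn0; exfalso; apply: nex.
  by exists u; left; split=> //; exists v.
have ns u v : e u v -> (0 <= Y u ord0 * Y v ord0)%R.
  move=> uv; rewrite leNgt; apply/negP => lt; apply: nex.
  by exists u; right; exists v.
have evp v : v != r -> e (par v) v by move=> vr; rewrite (edge_sym rt) (edge_par rt).
have [r0|r0] := eqVneq (Y r ord0) 0%R.
  have Y0 v : Y v ord0 = 0%R by elim/(rooted_ind rt): v => // v vr /(nz _ _ (evp v vr)).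
  by move/eqP: Yn0; apply; apply/matrixP=> i j; rewrite !mxE (ord1 j) Y0.
have pos v : (0 < Y r ord0 * Y v ord0)%R.
  elim/(rooted_ind rt): v => [|v vr pv].
    by rewrite -expr2 lt_neqAle sqr_ge0 eq_sym sqrf_eq0 r0.
  have v0 : Y v ord0 != 0%R.
    apply: contraTneq pv => v0; rewrite (nz v (par v)) ?(edge_par rt) //.
    by rewrite mulr0 ltxx.
  have := ns _ _ (evp v vr); move: pv v0.
  move: (Y r ord0) (Y v ord0) (Y (par v) ord0) => a b c ac b0 cb.
  rewrite lt_neqAle; apply/andP; split.
    by rewrite eq_sym mulf_neq0 //; apply: contraTneq ac => ->; rewrite mul0r ltxx.
  rewrite -(pmulr_rge0 _ ac); have -> : (a * c * (a * b) = a ^+ 2 * (c * b))%R by ring.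
  by rewrite mulr_ge0 // sqr_ge0.
have : (0 < \sum_v Y r ord0 * Y v ord0)%R.
  rewrite (bigD1 r) //=; apply: ltr_wpDr; last exact: pos.
  by apply: sumr_ge0 => v _; apply/ltW/pos.
by rewrite -mulr_sumr sumY mulr0 ltxx.
Qed.

Lemma core_center_exists n (e : rel 'I_n) (v0 : 'I_n) : exists c, c \in core_center e.
Proof.
exists [arg max_(v > v0) eccentric_subtree_number e v].
by rewrite inE; apply/forallP => w; case: arg_maxnP => // i _; apply.
Qed.

Lemma closest_centers_dist_le (R : realType) n (T : rel 'I_n) g0 c x :
  5 < n -> tree T -> 1 < g0 -> n - 3 <= 2 ^ (g0 - 1) + g0 ->
  (forall g : nat, 0 < g -> n - 3 <= 2 ^ (g - 1) + g -> g0 <= g) ->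
  x \in characteristic_center R T -> c \in core_center T ->
  (forall x' c', x' \in characteristic_center R T -> c' \in core_center T ->
     dist T x c <= dist T x' c') ->
  dist T x c <= dist_characteristic_core R (path_star n g0).
Proof.
move=> n5 tT g01 hg0 gmin xX cC min.
have [par [dep rt]] := tree_rooted c tT.
have [par' [dep' rt']] := tree_rooted x tT.
rewrite (dist_root rt); have dE := dist_root rt x.
have [->//|d0] := posnP (dep x).
have xc : x != c by rewrite -(dep_gt0 rt).
have n1 : 1 < n by apply: leq_ltn_trans n5.
set d := dep x in d0 dE *.
pose z := par x.
have zX : z \notin characteristic_center R T.
  apply/negP => /min/(_ cC); rewrite dE leqNgt => /negP; apply.
  by rewrite (dist_root rt) (dep_par rt) -/d prednK.
pose y := iter d.-1 par x.
have yx : anc par dep y x by apply: (anc_iter rt).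
have dy : dep y = 1 by rewrite (dep_iter rt) -/d -subn1 subKn.
have yr : y != c by rewrite -(dep_gt0 rt) dy.
have py : par y = c by apply/eqP; rewrite -(dep_eq0 rt) (dep_par rt) dy.
have yC : y \notin core_center T.
  apply/negP => /(min _ _ xX); rewrite dE leqNgt => /negP; apply.
  have : dist T x y <= d.-1 by apply: (dist_iter_par rt); rewrite -/d leq_pred.
  by move: d0; clear; lia.
have ecc := core_center_ltn cC yC.
have [Y fY cY] : exists2 Y : 'cV[R]_n, fiedler_vector T Y & characteristic_vertex T Y x.
  by move: xX; rewrite inE => /asboolP.
have [mu [smu _ LY]] := fY.
have eigY v : lap T (fun w => Y w ord0) v = (mu * Y v ord0)%R.
  by rewrite -laplacian_mulE LY mxE.
have zx : ~ (Y z ord0 * Y x ord0 < 0)%R.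
  move=> lt; case/negP: zX; rewrite inE; apply/asboolP; exists Y => //.
  by right; exists x => //; rewrite (edge_sym rt) (edge_par rt).
have [psi [psi0 psis psie psin]] := characteristic_test_function rt xc eigY cY zx.
have [v0 bv0] : exists v, below par dep x v.
  by have [v vn] := psin; exists v; apply: contraNT vn => /psis->.
have [u bu umax] : exists2 u, below par dep x u & forall v, below par dep x v -> dep v <= dep u.
  by have [u bu h] := arg_maxnP dep bv0; exists u.
have ux := below_dep rt bu; rewrite -/d in ux.
have leaf v : v != c -> par v != u.
  move=> vc; apply/eqP => E.
  have bv : below par dep x v by apply: (below_par rt xc vc); rewrite E.
  by have := umax v bv; rewrite (depS rt vc) E ltnn.
have yu : anc par dep y u by apply: (anc_trans rt yx); case/andP: bu.
have du : 1 < dep u by apply: leq_ltn_trans ux.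
have [w [yw dw cnt]] := core_branch_size rt yr py yu leaf du ecc gmin.
have dw' := dep_other_root rt rt' yr py yx yw; rewrite -/d in dw'.
(* w has depth at least 2, so the path from x through c towards w has at least
   this many vertices after x *)
pose K := d + 2.
have K0 : 0 < K by rewrite /K addn2.
have xw : ~~ anc par dep x w by apply: contra yw; apply: (anc_trans rt yx).
have Kw : 0 < K <= dep' w by rewrite K0 /K; move: dw dw'; clear; lia.
have [nu [phi [nu0 pe phi_pos phiK]]] := dirichlet_path R K0.
have munu := second_eigenvalue_le_path n1 rt rt' xc xw Kw nu0 pe phi_pos phiK smu psi0 psis psie psin.
have {}psie : (energy T psi <= nu * \sum_v psi v ^+ 2)%R.
  by apply: le_trans psie _; apply: ler_wpM2r => //; apply: sumr_ge0 => v _; apply: sqr_ge0.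
(* p + 1 levels lie below x *)
pose p := dep u - d - 1.
have up : dep u = d + p.+1 by rewrite /p; move: ux; clear; lia.
have room : K.+1 + #|[pred v | below par dep x v]| <= n.
  have cA := card_ancs rt' w.
  have dis : [disjoint ancs par' dep' w & [pred v | below par dep x v]].
    apply/pred0P => v /=; apply/negbTE/negP => /andP[]; rewrite inE => av bv.
    have {}bv : below par dep x v := bv.
    have vx : v != x by case/andP: bv.
    by move: bv; rewrite (below_anc rt rt' xc vx av) /below (negPf xw).
  have : #|ancs par' dep' w :|: [set v | below par dep x v]| <= n.
    by rewrite -[X in _ <= X]card_ord max_card.
  rewrite cardsU (_ : _ :&: _ = set0) ?cards0 ?subn0; last first.
    apply/setP=> v; rewrite in_set0 in_setI [v \in [set _ | _]]inE.
    by have := pred0P dis v.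
  have -> : #|[set v | below par dep x v]| = #|[pred v | below par dep x v]|.
    by apply: eq_card => v; rewrite inE.
  rewrite cA; case/andP: Kw => _; move: (dep' w) #|_| => a b.
  by clear; move: K => k; lia.
have [||||psi' [q0 qs qe qn]] := path_star_rearrangement (p := p) (D := K) (g := g0) rt xc psi0 psis
   _ _ (ltnW g01) _ _ room.
- move=> k kp; have [|v vu dv] := anc_at rt (k := d + k.+1) (v := u).
    by rewrite up leq_add2l.
  exists v => //; rewrite /below.
  have xv : anc par dep x v.
    apply: (anc_comp rt _ vu); first by case/andP: bu.
    by rewrite dv leq_addr.
  rewrite xv /=; apply: contra_eq_neq dv => ->.
  by rewrite -/d -[X in X != _]addn0 eqn_add2l.
- by move=> v bv; rewrite -up; apply: umax.
- by rewrite /K; move: cnt; rewrite up; clear; lia.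
- by move: cnt d0; rewrite up; clear; lia.
have m3 : 3 < n - g0 by move: cnt d0; rewrite up; clear; lia.
have Km : 0 < K < n - g0 by rewrite K0 /K; move: cnt; rewrite up; clear; lia.
have dn : d <= n by move: cnt; rewrite up; clear; lia.
apply: set_dist_ge => // v c' vX cC'.
have {}cC' : c' <= 2.
  apply: (path_star_core_le2 (ltnW g01) m3 _ cC'); rewrite -subnDA addnC subnDA.
  by move: hg0; clear; move: (2 ^ _) => P; lia.
have Kv : K <= v.
  have [Y' [mu' [smu' _ LY']] cY'] : exists2 Y : 'cV[R]_n,
      fiedler_vector (path_star n g0) Y & characteristic_vertex (path_star n g0) Y v.
    by move: vX; rewrite inE => /asboolP.
  have [qn' qe'] : (exists v, psi' v != 0)%R /\
      (energy (path_star n g0) psi' <= nu * \sum_v psi' v ^+ 2)%R.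
    split; last by rewrite qe; apply: le_trans psie _; apply: ler_wpM2l.
    apply: contrapT => nex; have [v1 /negP[]] := psin.
    have psi'0 v2 : (psi' v2 = 0)%R.
      by apply/eqP; apply: contraT => h; exfalso; apply: nex; exists v2.
    move: qn; under [X in (_ <= X)%R]eq_bigr do rewrite psi'0 expr0n.
    rewrite big1_eq => le0; rewrite -sqrf_eq0 eq_le sqr_ge0 andbT.
    apply: le_trans le0; rewrite (bigD1 v1) //= lerDl.
    by apply: sumr_ge0 => ? _; apply: sqr_ge0.
  have munu' := path_star_second_eigenvalue_le (ltnW g01) m3 Km nu0 pe phi_pos phiK q0 qs qn' qe' smu'.
  have eigY' v' : lap (path_star n g0) (fun w => Y' w ord0) v' = (mu' * Y' v' ord0)%R.
    by rewrite -laplacian_mulE LY' mxE.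
  case/andP: Km => _ Km.
  exact: (path_star_char_far Km K0 eigY' munu' pe phi_pos phiK cY').
apply: path_star_dist => //; first by apply: leq_trans m3.
  by move: Kv cC'; rewrite /K; clear; lia.
by move: cnt cC'; rewrite up; clear; lia.
Qed.

Theorem theorem5p17 (R : realType) (n : nat) (T : rel 'I_n) (g0 : nat)
  (hn : 6 <= n) (hT : tree T)
  (hg0_ge2 : 2 <= g0)
  (hg0 : n - 3 <= 2 ^ (g0 - 1) + g0)
  (hg0_min : forall g : nat, 0 < g -> n - 3 <= 2 ^ (g - 1) + g -> g0 <= g) :
  dist_characteristic_core R T
    <= dist_characteristic_core R (path_star n g0).
Proof.
have n0 : 0 < n by apply: leq_trans hn.
have [par [dep rt]] := tree_rooted (Ordinal n0) hT.
have [x1 x1X] := characteristic_center_exists R rt (leq_trans (isT : 1 < 6) hn).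
have [c1 c1C] := core_center_exists T (Ordinal n0).
pose P (xc : 'I_n * 'I_n) := (xc.1 \in characteristic_center R T) && (xc.2 \in core_center T).
have P1 : P (x1, c1) by rewrite /P x1X c1C.
have [[x c] /andP[xX cC] xcmin] := arg_minnP (fun xc : 'I_n * 'I_n => dist T xc.1 xc.2) P1.
apply: leq_trans (set_dist_le T xX cC) _.
apply: (closest_centers_dist_le hn hT hg0_ge2 hg0 hg0_min xX cC) => x' c' x'X c'C.
by apply: (xcmin (x', c')); rewrite /P x'X c'C.
Qed.
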